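(* Consider Brochette first-passage percolation on $\mathbb{Z}^2$ (so $d=2$) with passage-time distribution function $F$, and let $a$ be the infimum of the support of the passage-time distribution. Assume that $a=0$ and that $F(t)\sim c\,t^\beta$ as $t\to 0^+$ (i.e. $F(t)/(c\,t^\beta)\to 1$), where $\beta\ge 1$ and $c>0$. Then for all $\eta>0$ there exists $\varepsilon>0$ such that $$\liminf_{n\to+\infty}\mathbb{P}\left(H_n\ge \varepsilon n\right)\ge 1-\eta .$$ Furthermore, if the support of the passage-time distribution is bounded and if $\beta>1$, then for all $\eta>0$ there exists $K>0$ such that $$\liminf_{n\to+\infty}\mathbb{P}\left(H_n\le K n\right)\ge 1-\eta .$$
   Context: Lattice and paths. $\mathbb{Z}^d$ is equipped with the edge set $\mathbb{E}^d=\{\{x,y\}: x,y\in\mathbb{Z}^d,\ \|x-y\|_1=1\}$, and $(e_1,\dots,e_d)$ is the canonical basis of $\mathbb{R}^d$; $x_i$ denotes the $i$-th coordinate of $x$. A path is a (finite or infinite) sequence of edges such that consecutive edges share exactly one endpoint. Brochette first-passage percolation. An integer line is the set of points of $\mathbb{Z}^d$ lying on a common axis-parallel line of $\mathbb{R}^d$ (a line $x+\mathbb{Z}e_i$ with $x\in\mathbb{Z}^d$). Let $\Delta$ be the set of all integer lines, and let $(\tau_\delta)_{\delta\in\Delta}$ be i.i.d. non-negative real random variables with common cumulative distribution function $F$. Each edge $e\in\mathbb{E}^d$ belongs to a unique integer line $\delta$ (the one containing both its endpoints), and its passage time is $\tau_e:=\tau_\delta$; so all edges on the same line share the same passage time.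 The infimum $a\ge 0$ of the support of the passage-time distribution is characterized by $F(a+\varepsilon)>0$ and $F(a-\varepsilon)=0$ for all $\varepsilon>0$. Passage times and geodesics. The passage time of a path $\Gamma$ is $T(\Gamma)=\sum_{e\in\Gamma}\tau_e$. For $x,y\in\mathbb{Z}^d$, $T(x,y)=\inf_\Gamma T(\Gamma)$, the infimum being over all paths $\Gamma$ from $x$ to $y$. A path $\gamma$ from $x$ to $y$ is a geodesic from $x$ to $y$ if $T(\gamma)=T(x,y)$. Height. For a path $\gamma$ starting from $0$, its height is $$H(\gamma):=\max_{x\in e,\ e\in\gamma}\|x-x_1e_1\|_1 ,$$ the maximum being over all vertices $x$ that are endpoints of edges of $\gamma$. For $n\in\mathbb{N}$, $H_n:=\max_{\Gamma_n}H(\Gamma_n)$, where the maximum is over all geodesics $\Gamma_n$ from $0$ to $ne_1$ (under the hypotheses of the theorem, geodesics between all pairs of vertices exist almost surely). *)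

(* Defs.v *)
From HB Require Import structures.
From mathcomp Require Import all_boot all_order all_algebra finmap.
From mathcomp Require Import all_classical all_reals all_analysis.

Set Implicit Arguments.
Unset Strict Implicit.
Unset Printing Implicit Defensive.

Import Order.TTheory GRing.Theory Num.Theory.
Import numFieldNormedType.Exports.

Local Open Scope classical_set_scope.
Local Open Scope ring_scope.

(* The lattice Z^(d+1); the dimension is a successor so that e_1 exists. *)
Definition point (d : nat) := 'rV[int]_d.+1.

(* The canonical basis is numbered from 0: e_1 is [basis 0]. *)
Definition basis (d : nat) (i : 'I_d.+1) : point d := delta_mx 0 i.

Definition norm1 (d : nat) (x : point d) : nat := (\sum_i `|x ord0 i|)%N.

Definition edges (d : nat) : set {fset point d} :=
  [set e | exists x y : point d, norm1 (x - y) = 1%N /\ e = [fset x; y]%fset].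

Definition axis_line (d : nat) (x : point d) (i : 'I_d.+1) : set (point d) :=
  [set x + k *: basis i | k in [set: int]].

Definition Delta (d : nat) : set (set (point d)) :=
  [set D | exists x i, D = axis_line x i].
Arguments Delta d : clear implicits.

Lemma axis_line_Delta (d : nat) (x : point d) (i : 'I_d.+1) :
  axis_line x i \in Delta d.
Proof. by rewrite inE; exists x, i. Qed.

Definition line (d : nat) (x : point d) (i : 'I_d.+1) : Delta d :=
  exist _ (axis_line x i) (axis_line_Delta x i).

(* The line containing both endpoints of e; the first argument of [xget] is an
   irrelevant default, see [line_ofP] and [line_of_unique] below. *)
Definition line_of (d : nat) (e : {fset point d}) : Delta d :=
  xget (line 0 0) [set D : Delta d | [set` e] `<=` val D].

Definition share_one_endpoint (d : nat) : rel {fset point d} :=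
  fun e f => #|` (e `&` f)%fset| == 1%N.

Definition is_path (d : nat) (g : seq {fset point d}) : Prop :=
  {in g, forall e, edges e} /\ sorted (@share_one_endpoint d) g.

(* g is a path whose edges are successively traversed by a walk x :: p ending
   at y.  Asking only that x and y lie on the first and last edge would also
   allow, e.g., three edges with a common endpoint. *)
Definition path_between (d : nat) (x y : point d) (g : seq {fset point d}) :
    Prop :=
  is_path g /\
  exists p : seq (point d),
    last x p = y /\ g = pairmap (fun u v => [fset u; v]%fset) x p.

Section Deterministic.
Context {R : realType} {d : nat}.
Variable t : Delta d -> R.

Definition passage_time (g : seq {fset point d}) : R :=
  \sum_(e <- g) t (line_of e).

Definition travel_time (x y : point d) : R :=
  inf [set passage_time g | g in path_between x y].

Definition geodesic (x y : point d) : set (seq {fset point d}) :=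
  [set g | path_between x y g /\ passage_time g = travel_time x y].

End Deterministic.

Definition height (d : nat) (g : seq {fset point d}) : nat :=
  (\max_(e <- g) \max_(x <- e) norm1 (x - x ord0 ord0 *: basis 0)%R)%N.

(* H_n.  The supremum is taken in the extended reals: it is the maximum when
   that exists, and -oo (resp. +oo) if there is no geodesic (resp. if the
   heights of geodesics are unbounded). *)
Definition max_height (R : realType) (d : nat) (t : Delta d -> R) (n : nat) :
    \bar R :=
  ereal_sup [set (height g)%:R%:E | g in geodesic t 0 (n%:Z *: basis 0)].

Definition mutually_independent (dm : measure_display)
    (Omega : measurableType dm) (R : realType) (P : probability Omega R)
    (I : choiceType) (X : I -> {RV P >-> R}) : Prop :=
  forall (J : {fset I}) (B : I -> set R),
    (forall i, measurable (B i)) ->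
    P (\bigcap_(i in [set` J]) X i @^-1` B i) =
    (\prod_(i <- J) P (X i @^-1` B i))%E.

(* The (topological) support of the law with cumulative distribution
   function F: the points of increase of F. *)
Definition support_cdf (R : realType) (F : R -> R) : set R :=
  [set x | forall h, 0 < h -> F (x - h) < F (x + h)].

Lemma norm1_eq1 (d : nat) (z : point d) : norm1 z = 1%N ->
  exists i (k : int), k != 0 /\ z = k *: basis i.
Proof.
move=> z1.
have [i zi] : exists i, z ord0 i != 0.
  apply/existsP; rewrite -[X in is_true X]negbK negb_exists; apply/negP.
  move=> /forallP z0; move: z1; rewrite /norm1 big1// => i _.
  by have := z0 i; rewrite negbK => /eqP ->.
exists i, (z ord0 i); split=> //; apply/rowP => j; rewrite !mxE eqxx/=.
have [->|ji] := eqVneq j i; first by rewrite mulr1.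
rewrite mulr0; apply/eqP; rewrite -absz_eq0.
move: z1; rewrite /norm1 (bigD1 i)//= (bigD1 j)//= => z1.
move: zi z1; rewrite -absz_eq0.
by case: absz => // -[|?] _; rewrite ?addSn ?add0n => -[]; case: absz.
Qed.

Lemma axis_line_eq (d : nat) (x z : point d) (i : 'I_d.+1) :
  axis_line z i x -> axis_line z i = axis_line x i.
Proof.
move=> [k _ <-]; apply/seteqP; split=> _ [l _ <-].
  by exists (l - k) => //; rewrite -addrA -scalerDl [k + _]addrC subrK.
by exists (k + l) => //; rewrite scalerDl addrA.
Qed.

Lemma line_of_unique (d : nat) (e : {fset point d}) (D D' : Delta d) :
  edges e -> [set` e] `<=` val D -> [set` e] `<=` val D' -> D = D'.
Proof.
move=> [x [y [/norm1_eq1[i [k [k0 xyk]]] ->]]].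
have main (E : Delta d) : [set` [fset x; y]%fset] `<=` val E ->
    val E = axis_line x i.
  case: E => E /= /[dup]/set_mem [z [j ->]] _ sub.
  have /axis_line_eq zx : axis_line z j x by apply: sub; rewrite /= !inE eqxx.
  have : axis_line z j y by apply: sub; rewrite /= !inE eqxx orbT.
  rewrite zx => -[l _ ly]; congr axis_line; apply/eqP/negPn/negP => ji.
  have := congr1 (fun v : point d => v ord0 i) xyk.
  rewrite -ly opprD addrA subrr add0r !mxE !eqxx/= eq_sym (negPf ji).
  by rewrite mulr0 mulr1 oppr0 => /esym/eqP; rewrite (negPf k0).
by move=> /main DE /main D'E; apply/val_inj; rewrite DE D'E.
Qed.

Lemma line_ofP (d : nat) (e : {fset point d}) :
  edges e -> [set` e] `<=` val (line_of e).
Proof.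
move=> [x [y [/norm1_eq1[i [k [_ xyk]]] ->]]].
rewrite /line_of; case: xgetP => [D _ //|].
move=> /(_ (line x i)) []/=.
move=> u /=; rewrite !inE => /orP[]/eqP ->.
  by exists 0 => //; rewrite scale0r addr0.
by exists (- k) => //; rewrite scaleNr -xyk opprB addrC subrK.
Qed.

(* Main.v *)
(* Write h_k, v_j for the passage times of the horizontal and vertical lines and
   q = 1 / beta.  The fastest of N lines has a time of order N^(-q).

   A path of height at most eps n from 0 to n e_1 pays at least n times the
   minimum of 2 eps n + 1 of the h_k, which is s n^(1-q) with s large when eps
   is small.  But it crosses fast vertical lines near both ends, and going
   through these and a fast horizontal line at height at most n costs only
   O(n^(1-q)) between them, so such a path is not a geodesic.  A geodesic
   exists because leaving the box of radius r costs at least the sum over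
   i <= r of the minimal time in the box of radius i; as beta >= 1, almost
   surely this minimum is at least a constant over i for infinitely many i,
   and the sum diverges.

   For the upper bound, a zigzag along the fastest lines at dyadic distances
   from 0, and symmetrically from n e_1, gives T(0, n e_1) = O(n^(1-q)), whereas
   reaching height K n costs at least a constant times (K n)^(1-q), and q < 1. *)

Require Import Defs.
From mathcomp Require Import all_boot all_order all_algebra finmap.
From mathcomp Require Import all_classical all_reals all_analysis.
From mathcomp Require Import zify ring lra.

Set Implicit Arguments.
Unset Strict Implicit.
Unset Printing Implicit Defensive.

Import Order.TTheory GRing.Theory Num.Theory.
Import numFieldNormedType.Exports.

Local Open Scope classical_set_scope.
Local Open Scope ring_scope.

(** * Lattice walks *)

Notation vertex := (Defs.point 1).

Definition pt (a b : int) : vertex := \row_j (if j == 0 then a else b).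
Lemma ord2_cases (j : 'I_2) : j = 0 \/ j = 1.
Proof. by case: j => -[|[|//]] i; [left|right]; apply/val_inj. Qed.

Definition xc (p : vertex) : int := p 0 0.
Definition yc (p : vertex) : int := p 0 1.

Lemma xc_pt a b : xc (pt a b) = a. Proof. by rewrite /xc mxE. Qed.
Lemma yc_pt a b : yc (pt a b) = b. Proof. by rewrite /yc mxE. Qed.

Lemma pt_eta p : p = pt (xc p) (yc p).
Proof.
by apply/rowP => j; rewrite mxE /xc /yc; case: (ord2_cases j) => ->.
Qed.

Lemma pt0 : pt 0 0 = 0.
Proof. by apply/rowP => j; rewrite !mxE; case: ifP. Qed.

Lemma pt_e1 n : n%:Z *: Defs.basis 0 = pt n%:Z 0 :> vertex.
Proof.
apply/rowP => j; rewrite !mxE.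
by case: (ord2_cases j) => ->; rewrite /= ?mulr1 ?mulr0.
Qed.

Definition adj : rel vertex := fun u v => norm1 (u - v) == 1%N.

Lemma norm1_xy (u v : vertex) :
  norm1 (u - v) = (`|xc u - xc v| + `|yc u - yc v|)%N.
Proof.
rewrite /norm1 big_ord_recl big_ord1 !mxE /xc /yc.
by have -> : lift ord0 ord0 = 1 :> 'I_2 by apply/val_inj.
Qed.

Lemma adjE u v : adj u v = (`|xc u - xc v| + `|yc u - yc v| == 1)%N.
Proof. by rewrite /adj norm1_xy. Qed.

Lemma adjC u v : adj u v = adj v u.
Proof. by rewrite !adjE; congr (_ == _); lia. Qed.

Lemma adj_neq u v : adj u v -> u != v.
Proof. by rewrite adjE; apply: contraTneq => ->; rewrite !subrr. Qed.

Definition hline (k : int) : Delta 1 := line (pt 0 k) 0.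
Definition vline (j : int) : Delta 1 := line (pt j 0) 1.

Lemma hlineP (p : vertex) k : val (hline k) p <-> yc p = k.
Proof.
split=> [[l _ <-]|<-]; first by rewrite /yc !mxE /= mulr0 addr0.
exists (xc p) => //; rewrite [RHS]pt_eta; apply/rowP => j; rewrite !mxE.
by case: (ord2_cases j) => -> /=; rewrite ?mulr1 ?mulr0 ?addr0 ?add0r.
Qed.

Lemma vlineP (p : vertex) k : val (vline k) p <-> xc p = k.
Proof.
split=> [[l _ <-]|<-]; first by rewrite /xc !mxE /= mulr0 addr0.
exists (yc p) => //; rewrite [RHS]pt_eta; apply/rowP => j; rewrite !mxE.
by case: (ord2_cases j) => -> /=; rewrite ?mulr1 ?mulr0 ?addr0 ?add0r.
Qed.

Lemma hline_inj : injective hline.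
Proof.
move=> k l kl; have : val (hline l) (pt 0 k).
  by rewrite -kl; apply/hlineP; rewrite yc_pt.
by move/hlineP; rewrite yc_pt.
Qed.

Lemma vline_inj : injective vline.
Proof.
move=> k l kl; have : val (vline l) (pt k 0).
  by rewrite -kl; apply/vlineP; rewrite xc_pt.
by move/vlineP; rewrite xc_pt.
Qed.

Definition edge (u v : vertex) : {fset vertex} := [fset u; v]%fset.

Lemma adj_edges u v : adj u v -> edges (edge u v).
Proof. by move=> /eqP uv; exists u, v. Qed.

Lemma edges_adj u v : edges (edge u v) -> adj u v.
Proof.
move=> [x [y [xy E]]].
have xyn : x != y by apply: adj_neq; apply/eqP.
have : x \in edge u v by rewrite E !inE eqxx.
have : y \in edge u v by rewrite E !inE eqxx orbT.
have : u \in [fset x; y]%fset by rewrite -E !inE eqxx.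
have : v \in [fset x; y]%fset by rewrite -E !inE eqxx orbT.
rewrite !inE => /orP[]/eqP-> /orP[]/eqP->; rewrite ?orbb => /eqP H1 /eqP H2.
- by move: xyn; rewrite H1 eqxx.
- by rewrite adjC; apply/eqP.
- exact/eqP.
- by move: xyn; rewrite H2 eqxx.
Qed.

Lemma line_of_hline u v : adj u v -> yc u = yc v ->
  line_of (edge u v) = hline (yc u).
Proof.
move=> uv yuv; apply: (line_of_unique (adj_edges uv)).
  exact: (line_ofP (adj_edges uv)).
by move=> w /=; rewrite !inE => /orP[]/eqP->; apply/hlineP.
Qed.

Lemma line_of_vline u v : adj u v -> xc u = xc v ->
  line_of (edge u v) = vline (xc u).
Proof.
move=> uv yuv; apply: (line_of_unique (adj_edges uv)).
  exact: (line_ofP (adj_edges uv)).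
by move=> w /=; rewrite !inE => /orP[]/eqP->; apply/vlineP.
Qed.

Variant adj_spec u v : Delta 1 -> Prop :=
| AdjH of yc u = yc v & `|xc u - xc v|%N = 1%N : adj_spec u v (hline (yc u))
| AdjV of xc u = xc v & `|yc u - yc v|%N = 1%N : adj_spec u v (vline (xc u)).

Lemma adjP u v : adj u v -> adj_spec u v (line_of (edge u v)).
Proof.
move=> uv; have := uv; rewrite adjE => /eqP E.
have [yuv|yuv] := eqVneq (yc u) (yc v).
  by rewrite line_of_hline//; apply: AdjH => //; lia.
have xuv : xc u = xc v by lia.
by rewrite line_of_vline//; apply: AdjV => //; lia.
Qed.

(** Consecutive edges of a lattice walk share exactly one endpoint unless the walk turns back at
    once, so this is the edge condition of a path, read on vertices. *)
Definition nobacktrack (x : vertex) (p : seq vertex) :=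
  sorted (@share_one_endpoint 1) (pairmap edge x p).

Lemma share_one_adj u v w : adj u v -> adj v w -> u != w ->
  share_one_endpoint (edge u v) (edge v w).
Proof.
move=> uv vw uw; rewrite /share_one_endpoint; apply/eqP.
suff -> : (edge u v `&` edge v w)%fset = [fset v]%fset by rewrite cardfs1.
apply/fsetP => z; rewrite !inE.
have [->|zv] := eqVneq z v; first by rewrite orbT.
rewrite orbF/=; apply/negbTE/negP => /andP[/eqP-> /eqP]; exact/eqP.
Qed.

Lemma path_between_walk x y (g : seq {fset vertex}) : path_between x y g ->
  exists p, [/\ path adj x p, last x p = y & g = pairmap edge x p].
Proof.
move=> [[ge _] [p [px gp]]]; exists p; split=> //.
move: ge; rewrite gp; clear; elim: p x => //= z p IH x ge.
apply/andP; split; first by apply: edges_adj; apply: ge; rewrite inE eqxx.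
by apply: IH => e ep; apply: ge; rewrite inE ep orbT.
Qed.

(** * Costs of walks, and geodesics as cheapest walks *)

Section Deterministic.
Context {R : realType}.
Variable t : Delta 1 -> R.
Hypothesis t_ge0 : forall D, 0 <= t D.

Definition cost x p := passage_time t (pairmap edge x p).

Lemma cost_nil x : cost x [::] = 0.
Proof. by rewrite /cost /passage_time big_nil. Qed.

Lemma cost_cons x y p : cost x (y :: p) = t (line_of (edge x y)) + cost y p.
Proof. by rewrite /cost /passage_time /= big_cons. Qed.

Lemma cost_cat x p q : cost x (p ++ q) = cost x p + cost (last x p) q.
Proof. by rewrite /cost /passage_time pairmap_cat big_cat. Qed.

Lemma passage_time_ge0 g : 0 <= passage_time t g.
Proof. exact: sumr_ge0. Qed.

Lemma cost_ge0 x p : 0 <= cost x p.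
Proof. exact: passage_time_ge0. Qed.

(* Backtracks are erased from the end of the walk to its beginning. *)
Lemma walk_nobacktrack x p : path adj x p -> exists q,
  [/\ path adj x q, nobacktrack x q, last x q = last x p & cost x q <= cost x p].
Proof.
elim: p x => [|y p IH] x /=; first by exists [::].
move=> /andP[xy /IH[q [pq nq lq cq]]].
case: q pq nq lq cq => [|z q] /= pq nq lq cq.
  exists [:: y]; split=> //=; first by rewrite xy.
  by rewrite !cost_cons; rewrite lerD2l.
have [zx|zx] := eqVneq z x.
  move: pq => /andP[yz pq]; rewrite zx in lq pq cq *; exists q; split=> //.
    by move: nq; rewrite /nobacktrack/= zx => /path_sorted.
  rewrite cost_cons (le_trans _ (le_trans cq _))//.
    by rewrite cost_cons lerDr.
  by rewrite lerDr.
exists [:: y, z & q]; split=> //=.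
- by rewrite xy.
- rewrite /nobacktrack/=; apply/andP; split; last exact: nq.
  by move: pq => /andP[yz _]; apply: share_one_adj => //; rewrite eq_sym.
- by rewrite !(cost_cons x) lerD2l.
Qed.

(** Erasing backtracks cannot raise the cost when times are non-negative, so arbitrary walks may
    compete with paths. *)
Lemma walk_path_between x p : path adj x p -> exists2 g,
  path_between x (last x p) g & passage_time t g <= cost x p.
Proof.
move=> /walk_nobacktrack[q [pq nq lq cq]].
exists (pairmap edge x q) => //; split; last by exists q.
split=> //; move: pq; clear; elim: q x => //= z p IH x /andP[xz zp] e.
by rewrite inE => /predU1P[->|/(IH _ zp)//]; apply: adj_edges.
Qed.

(** Non-negative times bound the passage times below, so the real infimum [travel_time] is a genuine
    lower bound and attaining it amounts to minimality. *)
Lemma geodesicP x y g : geodesic t x y g <-> path_between x y g /\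
  forall g', path_between x y g' -> passage_time t g <= passage_time t g'.
Proof.
set A := [set passage_time t g | g in path_between x y].
have lA : lbound A 0 by move=> _ [h _ <-]; exact: passage_time_ge0.
split=> [[gxy gE]|[gxy gmin]]; split=> //.
  by move=> g' g'xy; rewrite gE; apply: ge_inf; [exists 0|exists g'].
apply/eqP; rewrite eq_le; apply/andP; split.
  by apply: lb_le_inf; [exists (passage_time t g), g|move=> _ [h /gmin ? <-]].
by apply: ge_inf; [exists 0|exists g].
Qed.

Lemma geodesic_walk x y g : geodesic t x y g -> exists p,
  [/\ path adj x p, last x p = y, g = pairmap edge x p &
    forall q, path adj x q -> last x q = y -> cost x p <= cost x q].
Proof.
move=> /geodesicP[/path_between_walk[p [px py gp]] gmin].
exists p; split=> // q qx qy; have [g' g'xy] := walk_path_between qx.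
apply: le_trans; rewrite /cost -gp; apply: gmin; by rewrite -qy.
Qed.

(** An upper bound on the travel time, witnessed by a walk: it composes by concatenation, with no
    infimum to handle. *)
Definition reach x y (r : R) :=
  exists p, [/\ path adj x p, last x p = y & cost x p <= r].

Lemma reach_trans y x z r s : reach x y r -> reach y z s -> reach x z (r + s).
Proof.
move=> [p [px py cp]] [q [qy qz cq]]; exists (p ++ q); split.
- by rewrite cat_path px py.
- by rewrite last_cat py.
- by rewrite cost_cat py lerD.
Qed.

Lemma reach_le x y r s : r <= s -> reach x y r -> reach x y s.
Proof. by move=> rs [p [px py cp]]; exists p; split=> //; apply: le_trans rs. Qed.

Lemma reach_refl x : reach x x 0.
Proof. by exists [::]; rewrite cost_nil. Qed.

Lemma edgeC u v : edge u v = edge v u.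
Proof. by rewrite /edge fsetUC. Qed.

Lemma reach_sym x y r : reach x y r -> reach y x r.
Proof.
move=> [p [px py cp]]; suff [q [qx qy cq]] : reach y x (cost x p).
  by exists q; split=> //; apply: le_trans cp.
rewrite -py; elim: p x px {py cp} => [|z p IH] x /=.
  by rewrite cost_nil => _; exact: reach_refl.
move=> /andP[xz /IH zp]; rewrite cost_cons addrC; apply: reach_trans zp _.
by exists [:: x]; split=> //=; rewrite ?(adjC z) ?xz// cost_cons cost_nil addr0 edgeC.
Qed.

Lemma reach_adj u v : adj u v -> reach u v (t (line_of (edge u v))).
Proof. by move=> uv; exists [:: v]; rewrite /= uv cost_cons cost_nil addr0. Qed.

Lemma reach_hline k a b : reach (pt a k) (pt b k) (`|b - a|%N%:R * t (hline k)).
Proof.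
wlog ab : a b / a <= b => [H|].
  have [/H//|/ltW /H/reach_sym] := leP a b; by rewrite distnC.
have -> : b = a + `|b - a|%N%:Z by lia.
set n := `|b - a|%N; have -> : absz (a + n%:Z - a)%R = n by lia.
elim: n => [|n IH]; first by rewrite mul0r addr0; exact: reach_refl.
rewrite -natr1 mulrDl mul1r; apply: reach_trans IH _.
have uv : adj (pt (a + n%:Z) k) (pt (a + n.+1%:Z) k).
  by rewrite adjE !xc_pt !yc_pt; apply/eqP; lia.
have := reach_adj uv; by rewrite line_of_hline ?yc_pt.
Qed.

Lemma reach_vline k a b : reach (pt k a) (pt k b) (`|b - a|%N%:R * t (vline k)).
Proof.
wlog ab : a b / a <= b => [H|].
  have [/H//|/ltW /H/reach_sym] := leP a b; by rewrite distnC.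
have -> : b = a + `|b - a|%N%:Z by lia.
set n := `|b - a|%N; have -> : absz (a + n%:Z - a)%R = n by lia.
elim: n => [|n IH]; first by rewrite mul0r addr0; exact: reach_refl.
rewrite -natr1 mulrDl mul1r; apply: reach_trans IH _.
have uv : adj (pt k (a + n%:Z)) (pt k (a + n.+1%:Z)).
  by rewrite adjE !xc_pt !yc_pt; apply/eqP; lia.
have := reach_adj uv; by rewrite line_of_vline ?xc_pt.
Qed.

End Deterministic.

(** * Cost of leaving a box, and existence of geodesics *)

Definition ints (r : nat) : seq int := [seq k%:Z - r%:Z | k <- iota 0 r.*2.+1].

Lemma mem_ints r k : (k \in ints r) = (`|k|%N <= r)%N.
Proof.
apply/mapP/idP => [[j]|kr]; first by rewrite mem_iota => ? ->; lia.
by exists (absz (k + r%:Z)%R); rewrite ?mem_iota; lia.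
Qed.

Lemma size_ints r : size (ints r) = r.*2.+1.
Proof. by rewrite size_map size_iota. Qed.

Definition lines (r : nat) : seq (Delta 1) :=
  [seq hline k | k <- ints r] ++ [seq vline k | k <- ints r].

Lemma size_lines r : size (lines r) = (r.*2.+1).*2.
Proof. by rewrite size_cat !size_map size_iota addnn. Qed.

Lemma mem_lines_h r k : (`|k|%N <= r)%N -> hline k \in lines r.
Proof. by rewrite -mem_ints => kr; rewrite mem_cat map_f. Qed.

Lemma mem_lines_v r k : (`|k|%N <= r)%N -> vline k \in lines r.
Proof. by rewrite -mem_ints => kr; rewrite mem_cat orbC map_f. Qed.

Lemma sub_lines r s : (r <= s)%N -> {subset lines r <= lines s}.
Proof.
move=> rs D; rewrite mem_cat => /orP[]/mapP[k]; rewrite mem_ints => kr ->.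
  by apply: mem_lines_h; apply: leq_trans rs.
by apply: mem_lines_v; apply: leq_trans rs.
Qed.

(** The sup norm, whose balls are the boxes of the argument. *)
Definition rad (p : vertex) : nat := maxn `|xc p| `|yc p|.

Lemma adj_lines u v : adj u v -> line_of (edge u v) \in lines (rad v).
Proof.
move=> /adjP[->|->] _; first by apply: mem_lines_h; rewrite leq_maxr.
by apply: mem_lines_v; rewrite leq_maxl.
Qed.

Lemma adj_rad u v : adj u v -> (rad v <= (rad u).+1)%N.
Proof. by rewrite adjE /rad => /eqP; lia. Qed.

Lemma rad_box r : [set p : vertex | (rad p <= r)%N] `<=`
  [set pt a b | a in [set` ints r] & b in [set` ints r]].
Proof.
move=> p /=; rewrite geq_max => /andP[xr yr].
exists (xc p); rewrite /= ?mem_ints//.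
by exists (yc p); rewrite /= ?mem_ints// -pt_eta.
Qed.

Lemma finite_walks (T : choiceType) (B : set T) (n : nat) : finite_set B ->
  finite_set [set p : seq T | (size p <= n)%N /\ forall x, x \in p -> B x].
Proof.
move=> fB; elim: n => [|n IH].
  apply: (@sub_finite_set _ _ [set [::]]) => // p [/=].
  by rewrite leqn0 size_eq0 => /eqP.
pose E := [set p : seq T | (size p <= n)%N /\ forall x, x \in p -> B x].
apply: (@sub_finite_set _ _ ([set [::]] `|` [set x :: p | x in B & p in E])).
  move=> [|x p] [/= pn pB]; [by left|right].
  exists x; first by apply: pB; rewrite inE eqxx.
  by exists p => //; split=> // y yp; apply: pB; rewrite inE yp orbT.
by rewrite finite_setU; split=> //; exact: finite_image2.
Qed.

Lemma finite_set_argmin (R : realDomainType) (T : choiceType) (A : set T)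
  (f : T -> R) : finite_set A -> A !=set0 -> exists2 a, A a & forall b, A b -> f a <= f b.
Proof.
move=> /finite_seqP[s ->] [x /= xs].
elim: s x xs => // y [|z s] IH x xs.
  by exists y => [|b] /=; rewrite !inE// => /eqP->.
have [a /= az amin] := IH z (mem_head _ _).
have [ya|ay] := leP (f y) (f a).
  exists y => [|b] /=; first by rewrite inE eqxx.
  by rewrite inE => /predU1P[->//|/amin]; apply: le_trans.
exists a => [|b] /=; first by rewrite inE az orbT.
by rewrite inE => /predU1P[->//|/amin//]; exact: ltW.
Qed.

Section Crossing.
Context {R : realType}.
Variable t : Delta 1 -> R.
Hypothesis t_ge0 : forall D, 0 <= t D.

(** The default [t (hline 0)] is itself one of the times compared, as [hline 0] is in every
    [lines r]; the value is therefore a true minimum. *)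
Definition minline r := \big[Num.min/t (hline 0)]_(D <- lines r) t D.

Lemma minlineP r x : (x <= minline r) <-> (forall D, D \in lines r -> x <= t D).
Proof.
have h0 : hline 0 \in lines r by apply: mem_lines_h.
suff H s : (x <= \big[Num.min/t (hline 0)]_(D <- s) t D) <->
    (x <= t (hline 0)) /\ forall D, D \in s -> x <= t D.
  by split=> [/H[]//|xD]; apply/H; split=> //; apply: xD.
elim: s => [|D s IH]; first by rewrite big_nil; split=> [//|[]].
rewrite big_cons le_min; split=> [/andP[xD /IH[x0 xs]]|[x0 xs]].
  by split=> // E; rewrite inE => /predU1P[->//|/xs].
rewrite xs ?inE ?eqxx//=; apply/IH; split=> // E Es.
by apply: xs; rewrite inE Es orbT.
Qed.

Lemma minline_le r D : D \in lines r -> minline r <= t D.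
Proof. exact: (minlineP r (minline r)).1. Qed.

Lemma minline_ge0 r : 0 <= minline r.
Proof. exact/minlineP. Qed.

Lemma minline_nincr r s : (r <= s)%N -> minline s <= minline r.
Proof. by move=> rs; apply/minlineP => D /(sub_lines rs); exact: minline_le. Qed.

(** A step raising the sup norm from [i] to [i.+1] uses a line of [lines i.+1], so this is a lower
    bound for the cost of reaching radius [r] from the origin. *)
Definition summin r := \sum_(i < r) minline i.+1.

Lemma summin0 : summin 0 = 0. Proof. by rewrite /summin big_ord0. Qed.

Lemma summinS r : summin r.+1 = summin r + minline r.+1.
Proof. by rewrite /summin big_ord_recr. Qed.

Lemma summin_add r s : (r <= s)%N -> summin r + (s - r)%N%:R * minline s <= summin s.
Proof.
move=> rs; rewrite -(subnKC rs) addKn; elim: (s - r)%N => [|k IH].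
  by rewrite addn0 mul0r addr0.
rewrite addnS summinS -natr1 mulrDl mul1r addrA lerD2r; apply: le_trans IH.
by rewrite lerD2l ler_wpM2l// minline_nincr.
Qed.

Lemma summin_le r s : (r <= s)%N -> summin r <= summin s.
Proof.
by move=> /summin_add; apply: le_trans; rewrite lerDl mulr_ge0// minline_ge0.
Qed.

(** The quantity [summin (rad _)] is a potential: an edge raises the radius by at most one, and the
    potential by at most the time of that edge. *)
Lemma summin_cost x p : path adj x p ->
  summin (rad (last x p)) <= summin (rad x) + cost t x p.
Proof.
elim: p x => /= [|z p IH] x; first by rewrite cost_nil addr0.
move=> /andP[xz /IH]; rewrite cost_cons addrA => /le_trans; apply.
rewrite lerD2r; have [zx|xz'] := leqP (rad z) (rad x).
  by rewrite (le_trans (summin_le zx))// lerDl.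
have zE : rad z = (rad x).+1 by apply/eqP; rewrite eqn_leq adj_rad.
by rewrite zE summinS lerD2l minline_le// -zE adj_lines.
Qed.

Lemma summin_cost_mem x y p : path adj x p -> y \in x :: p ->
  summin (rad y) <= summin (rad x) + cost t x p.
Proof.
move=> xp yp; case/splitPl: yp xp => p1 p2 <-; rewrite cat_path => /andP[xp1 _].
apply: le_trans (summin_cost xp1) _.
by rewrite lerD2l cost_cat lerDl cost_ge0.
Qed.

Lemma size_cost x p r : path adj x p -> (forall y, y \in p -> (rad y <= r)%N) ->
  (size p)%:R * minline r <= cost t x p.
Proof.
elim: p x => /= [|z p IH] x; first by rewrite mul0r cost_nil.
move=> /andP[xz zp] pr; rewrite -natr1 mulrDl mul1r cost_cons addrC lerD//.
  apply: minline_le; have zr : (rad z <= r)%N by apply: pr; rewrite inE eqxx.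
  by apply: (sub_lines zr); exact: adj_lines.
by apply: IH => // y yp; apply: pr; rewrite inE yp orbT.
Qed.

Lemma exists_geodesic x y : (forall r, 0 < minline r) ->
  (forall B, exists r, B < summin r) -> exists g, geodesic t x y g.
Proof.
move=> m_gt0 S_unb.
(* An L-shaped walk gives a reference cost [B]; only walks that cost no more need to be compared. *)
have [p0 [xp0 p0y _]] : reach t x y (`|xc y - xc x|%N%:R * t (hline (yc x)) +
    `|yc y - yc x|%N%:R * t (vline (xc y))).
  rewrite (pt_eta x) (pt_eta y) !xc_pt !yc_pt.
  by apply: reach_trans (reach_hline _ _ _ _) (reach_vline _ _ _ _).
pose B := cost t x p0.
(* Cost at most [B] confines a walk to radius [r], where every edge costs at least [minline r]; its
   length is then at most [L], which leaves finitely many walks. *)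
have [r Br] := S_unb (summin (rad x) + B).
pose L := Num.truncn (B / minline r).
pose A := [set p | [/\ path adj x p, last x p = y & cost t x p <= B]].
have fA : finite_set A.
  apply: (@sub_finite_set _ _ [set p | (size p <= L)%N /\
      forall z, z \in p -> (rad z <= r)%N]); last first.
    apply: finite_walks; apply: sub_finite_set (@rad_box r) _.
    by apply: finite_image2; apply/finite_seqP; exists (ints r).
  move=> p [xp py cp]; have pr z : z \in p -> (rad z <= r)%N.
    move=> zp; rewrite leqNgt; apply/negP => /ltnW /summin_le rz.
    have := summin_cost_mem xp; move=> /(_ z); rewrite inE zp orbT => /(_ isT) H.
    suff : summin r <= summin (rad x) + B by rewrite leNgt Br.
    by apply: le_trans rz (le_trans H _); rewrite lerD2l.
  split=> //; rewrite /L truncn_ge_nat ?divr_ge0 ?cost_ge0 ?minline_ge0//.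
  by rewrite ler_pdivlMr// (le_trans (size_cost xp pr)).
have [|p [xp py cp] pmin] := finite_set_argmin (cost t x) fA; first by exists p0.
have [g gxy gp] := walk_path_between t_ge0 xp.
exists g; apply/geodesicP => //; split; first by rewrite -py.
move=> _ /path_between_walk[q [xq qy ->]]; apply: le_trans gp _.
have [qB|Bq] := leP (cost t x q) B; first exact: pmin.
exact: le_trans cp (ltW Bq).
Qed.

(** From radius [r], choose [i >= 2 * r] with [i%:R * minline i >= d]: the terms between [r] and [i]
    add at least [(i - r) * minline i], hence [d / 2], and this can be repeated. *)
Lemma summin_unbounded d : 0 < d ->
  (forall k, exists2 i, (k <= i)%N & d <= i%:R * minline i) ->
  forall B, exists r, B < summin r.
Proof.
move=> d0 io B; suff H n : exists r, n%:R * (d / 2) <= summin r.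
  have [r rn] := H (Num.truncn (B / (d / 2))).+1.
  exists r; apply: lt_le_trans rn; rewrite -ltr_pdivrMr ?divr_gt0//.
  exact: truncnS_gt.
elim: n => [|n [r rn]]; first by exists 0%N; rewrite mul0r summin0.
have [i ri di] := io r.*2; exists i.
have := @summin_add r i ltac:(lia); apply: le_trans.
rewrite -natr1 mulrDl mul1r lerD//.
rewrite ler_pdivrMr// (le_trans di)// mulrAC ler_wpM2r ?minline_ge0//.
by rewrite -natrM ler_nat; lia.
Qed.

(** A discrete intermediate value theorem: the abscissa changes by at most one per step. *)
Lemma crossing x p j : path adj x p -> xc x <= j -> j <= xc (last x p) ->
  exists p1 p2, p = p1 ++ p2 /\ xc (last x p1) = j.
Proof.
elim: p x => /= [|z p IH] x.
  by move=> _ ? ?; exists [::], [::]; split=> //=; lia.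
move=> /andP[xz zp] xj jp; have [->|jx] := eqVneq j (xc x).
  by exists [::], (z :: p).
have zj : xc z <= j by move: xz; rewrite adjE; lia.
by have [p1 [p2 [-> <-]]] := IH z zp zj jp; exists (z :: p1), p2.
Qed.

(** Only horizontal steps change the abscissa, and each of them runs along a row of height at most
    [m]; vertical steps are bounded below by 0. *)
Lemma horizontal_cost x p (m : nat) (s : R) : path adj x p -> 0 <= s ->
  (forall k : int, (`|k| <= m)%N -> s <= t (hline k)) ->
  (forall z, z \in x :: p -> (`|yc z| <= m)%N) ->
  `|xc (last x p) - xc x|%N%:R * s <= cost t x p.
Proof.
move=> + s0 sm; elim: p x => /= [|z p IH] x; first by rewrite subrr mul0r cost_nil.
move=> /andP[xz zp] pm; rewrite cost_cons.
have {}IH : `|xc (last z p) - xc z|%N%:R * s <= cost t z p.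
  by apply: IH => // w wp; apply: pm; rewrite inE wp orbT.
have /sm xs : (`|yc x| <= m)%N by apply: pm; rewrite inE eqxx.
case: (adjP xz) => [_ d1|e _].
  apply: (@le_trans _ _ ((1 + `|xc (last z p) - xc z|)%N%:R * s)).
    by rewrite ler_wpM2r// ler_nat; lia.
  by rewrite natrD mulrDl mul1r lerD.
by rewrite e (le_trans IH)// lerDr.
Qed.

End Crossing.

(** * Detours and zigzags *)

Lemma height_vertex (z : vertex) :
  norm1 (z - z ord0 ord0 *: Defs.basis 0 : vertex) = `|yc z|%N.
Proof.
have -> : z ord0 ord0 *: Defs.basis 0 = pt (xc z) 0.
  apply/rowP => j; rewrite !mxE.
  by case: (ord2_cases j) => -> /=; rewrite ?mulr1 ?mulr0.
by rewrite norm1_xy xc_pt yc_pt !subrr subr0.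
Qed.

Lemma mem_pairmap_edge (x : vertex) p z : p != [::] -> z \in x :: p ->
  exists2 e, e \in pairmap edge x p & z \in e.
Proof.
elim: p x => // y [|w p] IH x _; rewrite inE => /predU1P[->|yp].
- by exists (edge x y); rewrite ?inE ?eqxx.
- by exists (edge x y); move: yp; rewrite !inE ?eqxx// => ->; rewrite orbT.
- by exists (edge x y); rewrite ?inE ?eqxx.
- by have [//|e ep ze] := IH y _ yp; exists e => //; rewrite inE ep orbT.
Qed.

Lemma pairmap_edge_mem (x : vertex) p e z :
  e \in pairmap edge x p -> z \in e -> z \in x :: p.
Proof.
elim: p x => // y p IH x; rewrite /= inE => /predU1P[->|ep ze].
  by rewrite !inE => /orP[]/eqP->; rewrite eqxx ?orbT.
by rewrite inE (IH y) ?orbT.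
Qed.

Lemma le_height (x : vertex) p z : p != [::] -> z \in x :: p ->
  (`|yc z| <= height (pairmap edge x p))%N.
Proof.
move=> p0 /(mem_pairmap_edge p0)[e ep ze]; rewrite -height_vertex.
apply: leq_trans (leq_bigmax_seq _ ep _) => //=.
exact: (@leq_bigmax_seq _ _ _
  (fun z : vertex => norm1 (z - z ord0 ord0 *: Defs.basis 0))).
Qed.

Lemma height_le (x : vertex) p m :
  (forall z, z \in x :: p -> (`|yc z| <= m)%N) ->
  (height (pairmap edge x p) <= m)%N.
Proof.
move=> pm; apply/bigmax_leqP_seq => e ep _; apply/bigmax_leqP_seq => z ze _.
by rewrite height_vertex; apply: pm; apply: pairmap_edge_mem ep ze.
Qed.

Section Geodesics.
Context {R : realType}.
Variable t : Delta 1 -> R.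
Hypothesis t_ge0 : forall D, 0 <= t D.

Lemma reach_geodesic x y g r :
  reach t x y r -> geodesic t x y g -> passage_time t g <= r.
Proof.
move=> [q [xq qy qr]] /(geodesic_walk t_ge0)[p [xp py -> pmin]].
by apply: le_trans qr; apply: pmin.
Qed.

(* A low path pays at least [s] for each of its horizontal steps, and can be
   short-cut between two fast vertical lines through a fast horizontal line. *)
Lemma low_not_geodesic (n m : nat) (j j' k : int) (u s : R) g :
  0 <= j -> j <= j' -> j' <= n%:Z -> 0 <= k -> k <= n%:Z -> (m <= n)%N ->
  t (vline j) <= u -> t (vline j') <= u -> t (hline k) <= u ->
  (forall k : int, (`|k| <= m)%N -> s <= t (hline k)) ->
  0 <= s -> 5 * n%:R * u < `|j' - j|%N%:R * s ->
  geodesic t (pt 0 0) (pt n%:Z 0) g -> (m < height g)%N.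
Proof.
move=> j0 jj' j'n k0 kn mn tj tj' tk sm s0 us /(geodesic_walk t_ge0).
move=> [p [xp pn -> pmin]]; rewrite ltnNge; apply/negP => hm.
have u0 : 0 <= u by apply: le_trans tk.
(* The empty walk has no edge through which [height] could see its vertices; it would force [n = 0]
   and [j = j'], against the strict inequality. *)
have p0 : p != [::].
  apply: contraTneq us => p0; move: pn; rewrite p0 /= => /(congr1 xc).
  rewrite !xc_pt => n0; rewrite -leNgt (_ : n = 0%N) ?mulr0 ?mul0r; last lia.
  by rewrite (_ : j' = j) ?subrr ?mul0r//; lia.
have low z : z \in pt 0 0 :: p -> (`|yc z| <= m)%N.
  by move=> zp; apply: leq_trans hm; apply: le_height.
(* The walk is cut at a visit to column [j] and a later visit to column [j']; only the middle piece
   [p2] will be replaced. *)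
have [||p1 [p' [pE p1j]]] := @crossing _ p j xp.
- by rewrite xc_pt.
- by rewrite pn xc_pt; lia.
move: xp; rewrite pE cat_path => /andP[xp1 xp'].
have p'n : last (last (pt 0 0) p1) p' = pt n%:Z 0 by rewrite -last_cat -pE.
have [||p2 [p3 [p'E p2j]]] := @crossing _ p' j' xp'.
- by rewrite p1j.
- by rewrite p'n xc_pt.
move: xp'; rewrite p'E cat_path; set a := last _ p1; set b := last a p2.
move=> /andP[ap2 bp3].
have a_low : (`|yc a| <= m)%N by apply: low; rewrite pE -cat_cons mem_cat mem_last.
have p2_low z : z \in a :: p2 -> (`|yc z| <= m)%N.
  rewrite inE => /predU1P[->//|zp2]; apply: low.
  by rewrite pE p'E inE !mem_cat zp2 !orbT.
have b_low : (`|yc b| <= m)%N by apply: p2_low; rewrite mem_last.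
have mid := horizontal_cost t_ge0 ap2 s0 sm p2_low.
(* The detour follows column [j], row [k] and column [j']. Its vertical moves have length at most
   [2 * n], since [m] and [k] are at most [n], and its horizontal one at most [n]: in all
   [5 * n]. *)
have [q [aq qb cq]] : reach t a b (5 * n%:R * u).
  have := reach_trans (reach_trans (reach_vline t j (yc a) k)
    (reach_hline t k j j')) (reach_vline t j' k (yc b)).
  have <- : a = pt j (yc a) by rewrite -p1j -pt_eta.
  have <- : b = pt j' (yc b) by rewrite -p2j -pt_eta.
  apply: reach_le.
  suff : `|k - yc a|%N%:R * t (vline j) <= (2 * n)%N%:R * u /\
      `|j' - j|%N%:R * t (hline k) <= n%:R * u /\
      `|yc b - k|%N%:R * t (vline j') <= (2 * n)%N%:R * u.
    by rewrite natrM; lra.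
  by split; [|split]; apply: ler_pM => //; rewrite ler_nat; lia.
have xq : path adj (pt 0 0) (p1 ++ q ++ p3) by rewrite !cat_path xp1 aq qb.
have lq : last (pt 0 0) (p1 ++ q ++ p3) = pt n%:Z 0.
  by rewrite !last_cat -/a qb -p'n p'E last_cat.
have := pmin _ xq lq; rewrite pE p'E !cost_cat qb -/a -/b.
rewrite lerD2l lerD2r => /(le_trans mid); rewrite p1j p2j.
by move=> /le_trans/(_ cq); rewrite leNgt us.
Qed.

(** Beyond height [m] the walk has left the box of radius [m] and paid [summin m], a sum of [m]
    terms each at least [minline m]. *)
Lemma tall_passage_time (m n : nat) g :
  geodesic t (pt 0 0) (pt n%:Z 0) g -> (m < height g)%N ->
  m%:R * minline t m <= passage_time t g.
Proof.
move=> /(geodesic_walk t_ge0)[p [xp _ -> _]] mg.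
have [z zp mz] : exists2 z, z \in pt 0 0 :: p & (m < `|yc z|)%N.
  apply: contrapT => /forall2NP H; move: mg; rewrite ltnNge => /negP; apply.
  by apply: height_le => z zp; have [//|/negP] := H z; rewrite -leqNgt.
have := summin_cost_mem t_ge0 xp zp.
have -> : rad (pt 0 0) = 0%N by rewrite /rad xc_pt yc_pt maxnn.
rewrite summin0 add0r; apply: le_trans.
have mz' : (m <= rad z)%N by rewrite (leq_trans (ltnW mz)) ?leq_maxr.
apply: le_trans (summin_le t_ge0 mz').
by have := summin_add t (leq0n m); rewrite subn0 summin0 add0r.
Qed.

(* Zigzag between fast lines at dyadic distances; the term [4 * _] on the left
   makes the induction go through. *)
Lemma reach_staircase (x0 : int) (xs ys : nat -> int) (u : nat -> R) :
  (`|xs 0 - x0| <= 1)%N -> (`|ys 0| <= 1)%N ->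
  (forall i, (`|xs i.+1 - xs i| <= 2 ^ i.+2)%N) ->
  (forall i, (`|ys i.+1 - ys i| <= 2 ^ i.+2)%N) ->
  forall m, (forall i, (i <= m)%N ->
    t (vline (xs i)) <= u i /\ t (hline (ys i)) <= u i) ->
  reach t (pt x0 0) (pt (xs m) (ys m)) (t (hline 0) +
    8 * (\sum_(i < m.+1) 2 ^+ i * u i) - 4 * (2 ^+ m * u m)).
Proof.
move=> x01 y01 xS yS; elim=> [|m IH] tu.
  have [tx ty] := tu 0%N (leqnn _).
  have := reach_trans (reach_hline t 0 x0 (xs 0))
    (reach_vline t (xs 0) 0 (ys 0)); apply: reach_le.
  rewrite big_ord1 expr0 !mul1r.
  have : `|xs 0%N - x0|%N%:R * t (hline 0) <= 1 * t (hline 0).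
    by rewrite ler_wpM2r// lern1.
  have : `|ys 0%N - 0|%N%:R * t (vline (xs 0%N)) <= 1 * u 0%N.
    by rewrite subr0 ler_pM// lern1.
  have : 0 <= u 0%N by apply: le_trans tx.
  lra.
have [tx ty] := tu m (leqnSn _); have [tx' ty'] := tu m.+1 (leqnn _).
have {}IH := IH (fun i im => tu i (leqW im)).
(* The horizontal move costs at most [4 * (2 ^+ m * u m)], the very term subtracted in the induction
   hypothesis; the vertical one costs at most [2 * (2 ^+ m.+1 * u m.+1)], within the new term. *)
have := reach_trans (reach_trans IH (reach_hline t (ys m) (xs m) (xs m.+1)))
  (reach_vline t (xs m.+1) (ys m) (ys m.+1)); apply: reach_le.
have : `|xs m.+1 - xs m|%N%:R * t (hline (ys m)) <= (2 ^ m.+2)%N%:R * u m.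
  by rewrite ler_pM// ler_nat.
have : `|ys m.+1 - ys m|%N%:R * t (vline (xs m.+1)) <= (2 ^ m.+2)%N%:R * u m.+1.
  by rewrite ler_pM// ler_nat.
have : 0 <= 2 ^+ m * u m.+1 by rewrite mulr_ge0 ?exprn_ge0// (le_trans _ tx').
rewrite [in X in _ -> _ -> _ -> _ <= X]big_ord_recr /= !natrX !exprS; lra.
Qed.

(** Two staircases start from the two endpoints and use the same rows [ys], so they end at the same
    height and one horizontal move joins them. *)
Lemma dyadic_upper_bound (n m : nat) (u : nat -> R) (xs xs' ys : nat -> int) g :
  (n <= 2 ^ m)%N ->
  (forall i, (2 ^ i)%N%:Z <= xs i < (2 ^ i.+1)%N%:Z) ->
  (forall i, (2 ^ i)%N%:Z <= xs' i < (2 ^ i.+1)%N%:Z) ->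
  (forall i, (2 ^ i)%N%:Z <= ys i < (2 ^ i.+1)%N%:Z) ->
  (forall i, (i <= m)%N -> [/\ t (vline (xs i)) <= u i,
    t (vline (n%:Z - xs' i)) <= u i & t (hline (ys i)) <= u i]) ->
  geodesic t (pt 0 0) (pt n%:Z 0) g ->
  passage_time t g <= 2 * t (hline 0) + 16 * \sum_(i < m.+1) 2 ^+ i * u i.
Proof.
move=> nm xsP xsP' ysP tu; apply: reach_geodesic.
have x0 := xsP 0%N; have x0' := xsP' 0%N; have y0 := ysP 0%N.
have e i : (2 ^ i.+2 = 2 * 2 ^ i.+1)%N by rewrite expnS.
have e' i : (2 ^ i.+1 = 2 * 2 ^ i)%N by rewrite expnS.
have Sy i : (`|ys i.+1 - ys i| <= 2 ^ i.+2)%N.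
  by have := ysP i; have := ysP i.+1; have := e i; have := e' i; lia.
have r1 : reach t (pt 0 0) (pt (xs m) (ys m)) (t (hline 0) +
    8 * (\sum_(i < m.+1) 2 ^+ i * u i) - 4 * (2 ^+ m * u m)).
  apply: reach_staircase => // [||i|i /tu[]//].
  - by rewrite expn0 expn1 in x0; lia.
  - by rewrite expn0 expn1 in y0; lia.
  - by have := xsP i; have := xsP i.+1; have := e i; have := e' i; lia.
have r2 : reach t (pt n%:Z 0) (pt (n%:Z - xs' m) (ys m)) (t (hline 0) +
    8 * (\sum_(i < m.+1) 2 ^+ i * u i) - 4 * (2 ^+ m * u m)).
  apply: (@reach_staircase _ (fun i => n%:Z - xs' i)) => // [||i|i /tu[]//].
  - by rewrite expn0 expn1 in x0'; lia.
  - by rewrite expn0 expn1 in y0; lia.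
  - by have := xsP' i; have := xsP' i.+1; have := e i; have := e' i; lia.
have := reach_trans (reach_trans r1
  (reach_hline t (ys m) (xs m) (n%:Z - xs' m))) (reach_sym r2).
apply: reach_le.
have [_ _ ty] := tu m (leqnn m).
(* This fits in the [8 * (2 ^+ m * u m)] that the two staircases leave over. *)
have : (absz (n%:Z - xs' m - xs m)%R)%:R * t (hline (ys m)) <= (5 * 2 ^ m)%N%:R * u m.
  rewrite ler_pM// ler_nat.
  by have := xsP m; have := xsP' m; have := e' m; lia.
have : 0 <= 2 ^+ m * u m by rewrite mulr_ge0 ?exprn_ge0// (le_trans _ ty).
by rewrite natrM natrX; lra.
Qed.

End Geodesics.

(** * Random passage times *)

Lemma limn_einf_ge (R : realType) (u : (\bar R)^nat) (x : \bar R) :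
  (\forall n \near \oo, x <= u n)%E -> (x <= limn_einf u)%E.
Proof.
move=> [N _ xu]; rewrite limn_einf_lim; apply: lime_ge; first exact: is_cvg_einfs.
exists N => // n /= Nn; apply: le_ereal_inf_tmp => _ [k /= nk <-].
by apply: xu; apply: leq_trans nk.
Qed.

Lemma powR_exprn (R : realType) (a q : R) n : 0 <= a -> (a ^+ n) `^ q = (a `^ q) ^+ n.
Proof.
move=> a0; elim: n => [|n IH]; first by rewrite !expr0 powR1.
by rewrite !exprS powRM ?exprn_ge0// IH.
Qed.

Lemma mulr_div_powR (R : realType) (x z q : R) : 0 < x -> 0 <= z -> q < 1 ->
  x * (z / x) `^ q = z `^ q * x `^ (1 - q).
Proof.
move=> x0 z0 q1; rewrite powRM ?invr_ge0 ?(ltW x0)//.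
rewrite -powR_inv1 ?(ltW x0)// -powRrM mulN1r mulrCA; congr (_ * _).
by rewrite -[in RHS]mulr_powRB1 ?subr_gt0 ?(ltW x0)// [1 - q]addrC addrK.
Qed.

Lemma sum_geometric_le (R : realFieldType) (r : R) m : 0 <= r -> r < 1 ->
  \sum_(i < m.+1) r ^+ (m - i) <= (1 - r)^-1.
Proof.
move=> r0 r1; have r1' : 0 < 1 - r by rewrite subr_gt0.
elim: m => [|m IH].
  by rewrite big_ord1 subnn expr0 invf_ge1 ?gerBl.
rewrite big_ord_recr /= subnn expr0.
rewrite (eq_bigr (fun i : 'I_m.+1 => r * r ^+ (m - i))) => [|i _]; last first.
  by rewrite -exprS -subSn// -ltnS.
rewrite -mulr_sumr; apply: le_trans (_ : r * (1 - r)^-1 + 1 <= _).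
  by rewrite lerD2r ler_wpM2l.
by rewrite le_eqVlt; apply/orP; left; apply/eqP; field; rewrite gt_eqF.
Qed.

(** Past a bound of the support [F] is constant, as otherwise the supremum of the points where it
    keeps the value [F x] would be a point of increase. The constant must be the limit 1. *)
Lemma cdf_one (R : realType) (F : R -> R) : {homo F : x y / x <= y} ->
  (F x @[x --> +oo] --> (1 : R)) -> bounded_set (support_cdf F) ->
  exists2 b, 0 < b & F b = 1.
Proof.
move=> ndF F1 [M [_ bM]].
pose x := Num.max 1 (M + 2).
have x0 : 0 < x by rewrite lt_max ltr01.
have xM : M + 1 < x by rewrite lt_max ltrD2l ltr1n orbT.
suff Fx y : x <= y -> F y = F x.
  exists x => //; have : F z @[z --> +oo] --> F x.
    apply: cvg_near_cst; near=> z; apply: Fx; near: z.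
    by apply: nbhs_pinfty_ge; rewrite num_real.
  by move=> /(cvg_unique (@Rhausdorff R))/(_ F1).
move=> xy; apply: contrapT => /eqP yx.
pose E := [set z | x <= z /\ F z = F x].
have Ex : E x by split.
have Ey : ubound E y.
  move=> z [xz zx]; rewrite leNgt; apply/negP => /ltW yz.
  by move/negP: yx; apply; rewrite eq_le (ndF _ _ xy) andbT -zx ndF.
have hE : has_sup E by split; [exists x|exists y].
have xs : x <= sup E by apply: ub_le_sup => //; exists y.
have : ~ support_cdf F (sup E).
  have M1 : M < M + 1 by rewrite ltrDl.
  move=> /(bM _ M1); apply/negP; rewrite -ltNge (lt_le_trans xM)// (le_trans xs)//.
  exact: ler_norm.
(* Since [F] does not increase across [sup E], the point [sup E + h] also belongs to [E], which is
   absurd. *)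
move=> /existsNP[h /not_implyP[h0 /negP]]; rewrite -leNgt => hF.
have [z [xz zx] hz] := sup_adherent h0 hE.
have : E (sup E + h).
  split; first by rewrite (le_trans xs)// lerDl ltW.
  have xsh : x <= sup E + h by rewrite (le_trans xs)// lerDl ltW.
  apply/eqP; rewrite eq_le (ndF _ _ xsh) andbT.
  by rewrite (le_trans hF)// -zx ndF// ltW.
move=> /(ub_le_sup (ex_intro _ y Ey)); rewrite gerDl.
by apply/negP; rewrite -ltNge.
Unshelve. all: by end_near.
Qed.

Section Environment.
Context {R : realType} {dm : measure_display} {Omega : measurableType dm}.
Context {P : probability Omega R}.

Definition rare (A : set Omega) (a : R) := measurable A /\ (P A <= a%:E)%E.

Lemma prob_ge (E B : set Omega) (e : R) : measurable E -> rare B e ->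
  ~` B `<=` E -> ((1 - e)%:E <= P E)%E.
Proof.
move=> mE [mB Pe] BE; apply: (@le_trans _ _ (P (~` B))); last first.
  by apply: le_measure; rewrite ?inE//; exact: measurableC.
by rewrite probability_setC// EFinB leeB.
Qed.

Lemma rare_le (A : set Omega) (a b : R) : a <= b -> rare A a -> rare A b.
Proof. by move=> ab [mA Pa]; split=> //; rewrite (le_trans Pa)// lee_fin. Qed.

Lemma rare_setU (A B : set Omega) (a b : R) : rare A a -> rare B b ->
  rare (A `|` B) (a + b).
Proof.
move=> [mA Pa] [mB Pb]; split; first exact: measurableU.
by rewrite EFinD; apply: le_trans (measureU2 _ mA mB) (leeD _ _).
Qed.

Lemma rare_bigsetU (I : Type) (s : seq I) (A : I -> set Omega) (a : I -> R) :
  (forall i, rare (A i) (a i)) ->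
  rare (\big[setU/set0]_(i <- s) A i) (\sum_(i <- s) a i).
Proof.
move=> Aa; elim: s => [|i s IH]; last by rewrite !big_cons; exact: rare_setU.
by rewrite !big_nil; split; rewrite ?measure0.
Qed.

(** Continuity of the measure from below: no sum of bounds is needed for an increasing union. *)
Lemma rare_bigcup (A : (set Omega)^nat) (e : R) : (forall i, rare (A i) e) ->
  {homo A : i j / (i <= j)%N >-> i `<=` j} -> rare (\bigcup_i A i) e.
Proof.
move=> Ae ndA; have mA i : measurable (A i) by case: (Ae i).
have mU : measurable (\bigcup_i A i) by exact: bigcup_measurable.
split=> //; have := nondecreasing_cvg_mu (mu := P) mA mU.
move=> /(_ (fun i j ij => introT (subsetPset _ _) (ndA i j ij))).
by move=> /cvge_to_le; apply; apply: nearW => i; case: (Ae i).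
Qed.

Variable tau : Delta 1 -> {RV P >-> R}.
Variable F : R -> R.
Hypothesis tau_ge0 : forall D w, 0 <= tau D w.
Hypothesis tau_indep : mutually_independent tau.
Hypothesis tau_cdf : forall D t, cdf (tau D) t = (F t)%:E.

Notation env w := (fun D => tau D w).

Lemma cdf_ge0_le1 x : 0 <= F x <= 1.
Proof.
rewrite -!lee_fin -(tau_cdf (hline 0)).
by rewrite cdf_ge0 cdf_le1.
Qed.

Lemma cdf_homo : {homo F : x y / x <= y}.
Proof.
by move=> x y xy; rewrite -lee_fin -!(tau_cdf (hline 0)) cdf_nondecreasing.
Qed.

Lemma cdf_cvg1 : F x @[x --> +oo] --> (1 : R).
Proof.
have := cvg_cdfy1 (tau (hline 0)).
under eq_cvg do rewrite tau_cdf.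
by move=> /fine_cvgP[].
Qed.

Lemma measurable_fast D x : measurable [set w | tau D w <= x].
Proof.
rewrite -[X in measurable X]setTI; exact: measurable_fun_le.
Qed.

Lemma prob_fast D x : P [set w | tau D w <= x] = (F x)%:E.
Proof.
by rewrite -(tau_cdf D) /cdf /distribution /pushforward; congr (P _).
Qed.

Definition some_fast (s : seq (Delta 1)) (x : R) : set Omega :=
  \big[setU/set0]_(D <- s) [set w | tau D w <= x].

Lemma some_fastN s x w : (~` some_fast s x) w ->
  forall D, D \in s -> x < tau D w.
Proof.
rewrite /some_fast -bigcup_seq => H D Ds; rewrite ltNge; apply/negP => Dx.
by apply: H; exists D.
Qed.

Lemma rare_some_fast s x : rare (some_fast s x) ((size s)%:R * F x).
Proof.
rewrite mulr_natl -iter_addr_0 -(count_predT s) -big_const_seq.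
apply: rare_bigsetU => D; split; first exact: measurable_fast.
by rewrite prob_fast.
Qed.

Definition all_slow (s : seq (Delta 1)) (x : R) : set Omega :=
  \bigcap_(D in [set` s]) tau D @^-1` `]x, +oo[.

Lemma measurable_all_slow s x : measurable (all_slow s x).
Proof.
apply: fin_bigcap_measurable => // D _.
by rewrite -[X in measurable X]setTI; exact: measurable_funP.
Qed.

Lemma all_slowN s x w : (~` all_slow s x) w ->
  exists2 D, D \in s & tau D w <= x.
Proof.
move=> H; apply: contrapT => /forall2NP H'; apply: H => D /= Ds.
rewrite in_itv/= andbT; have [//|] := H' D.
by move=> /negP; rewrite -ltNge.
Qed.

(** Independence turns the intersection into a product over distinct lines; [uniq s] makes the
    number of factors the length of the list. *)
Lemma prob_all_slow s x : uniq s ->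
  P (all_slow s x) = ((1 - F x) ^+ size s)%:E.
Proof.
move=> us; have := tau_indep [fset D in s]%fset (fun=> measurable_itv `]x, +oo[).
rewrite /all_slow; have -> : [set` [fset D in s]%fset] = [set` s].
  by apply/seteqP; split=> D /=; rewrite !inE.
move=> ->; have slow D : P (tau D @^-1` `]x, +oo[) = (1 - F x)%:E.
  have -> : tau D @^-1` `]x, +oo[ = ~` [set w | tau D w <= x].
    by apply/seteqP; split=> w /=; rewrite in_itv/= andbT ltNge => /negP.
  by rewrite probability_setC ?prob_fast//; exact: measurable_fast.
rewrite (eq_bigr (fun=> (1 - F x)%:E)) => [|D _]; last exact: slow.
rewrite prodEFin big_const_seq count_predT iter_mulr_1; congr (_ ^+ _)%:E.
by apply: perm_size; apply: uniq_perm => // D; rewrite inE.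
Qed.

(* Bernoulli's inequality gives [(1 - p)^N (1 + N p) <= 1]. *)
Lemma rare_all_slow s x y : uniq s -> 0 < y -> y <= (size s)%:R * F x \/
  (0 < size s)%N /\ F x = 1 -> rare (all_slow s x) y^-1.
Proof.
move=> us y0 H; split; first exact: measurable_all_slow.
rewrite prob_all_slow// lee_fin.
case: H => [yF|[s0 ->]]; last first.
  by rewrite subrr expr0n gtn_eqF// invr_ge0 ltW.
rewrite -[leRHS]mul1r ler_pdivlMr//.
have /andP[F0 F1] := cdf_ge0_le1 x.
apply: (@le_trans _ _ ((1 - F x) ^+ size s * (1 + (size s)%:R * F x))).
  rewrite ler_wpM2l ?exprn_ge0 ?subr_ge0// (le_trans yF)// lerDr//.
elim: (size s) => [|n IH]; first by rewrite expr0 mul0r addr0 mulr1.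
apply: le_trans IH; rewrite exprSr -mulrA ler_wpM2l ?exprn_ge0 ?subr_ge0//.
rewrite -natr1; have := sqr_ge0 (F x); have : 0 <= (n%:R : R) by [].
nra.
Qed.

(** There are countably many edge sequences, so minimality is a countable intersection of measurable
    comparisons. *)
Lemma measurable_geodesic x y g : measurable [set w | geodesic (env w) x y g].
Proof.
have [gxy|gxy] := pselect (path_between x y g); last first.
  by rewrite (_ : mkset _ = set0)//; apply/seteqP; split=> // w [].
have mT h : measurable_fun [set: Omega] (fun w => passage_time (env w) h).
  by apply: measurable_sum => e; exact: measurable_funP.
have -> : [set w | geodesic (env w) x y g] = ~` \bigcup_h
    (if pselect (path_between x y h)
     then ~` [set w | passage_time (env w) g <= passage_time (env w) h]
     else set0).
  apply/seteqP; split=> [w|w H].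
    move=> /geodesicP-/(_ (fun D => tau_ge0 D w))[_ gmin] [h _].
    by case: pselect => // hxy /=; apply; apply: gmin.
  apply/geodesicP => [D|]; first exact: tau_ge0.
  split=> // h hxy; apply: contrapT => gh; apply: H; exists h => //.
  by case: pselect.
apply: measurableC; apply: countable_bigcupT_measurable => [|h].
  exact: countableP.
case: pselect => [hxy|_] /=; last exact: measurable0.
apply: measurableC.
by rewrite -[X in measurable X]setTI; apply: measurable_fun_le.
Qed.

Lemma measurable_geodesics x y (A : set (seq {fset vertex})) :
  measurable [set w | exists2 g, A g & geodesic (env w) x y g].
Proof.
have -> : [set w | exists2 g, A g & geodesic (env w) x y g] =
    \bigcup_g ([set w | geodesic (env w) x y g] `&` [set _ | A g]).
  by apply/seteqP; split=> [w [g Ag gw]|w [g _ [gw Ag]]]; exists g.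
apply: countable_bigcupT_measurable => [|g]; first exact: countableP.
apply: measurableI; first exact: measurable_geodesic.
have [Ag|nAg] := pselect (A g).
  by rewrite (_ : mkset _ = setT)//; apply/seteqP; split.
by rewrite (_ : mkset _ = set0)//; apply/seteqP; split.
Qed.

(** Heights are integers: if [N.+1] is the least integer above [x], a supremum at least [x] exceeds
    [N], so some geodesic has height at least [N.+1]. Positivity of [x] makes this least integer a
    successor. *)
Lemma max_height_geE n (x : R) : 0 < x ->
  [set w | (x%:E <= max_height (env w) n)%E] =
  [set w | exists2 g, x <= (height g)%:R &
    geodesic (env w) (pt 0 0) (pt n%:Z 0) g].
Proof.
move=> x0; rewrite /max_height -pt0 pt_e1; apply/seteqP; split=> w /=; last first.
  move=> [g xg gw]; apply: le_ereal_sup_tmp.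
  by exists (height g)%:R%:E => //; exists g.
have exN : exists N, x <= N%:R by exists (Num.truncn x).+1; rewrite ltW// truncnS_gt.
case: (ex_minnP exN) => -[|N] xN Nmin; first by rewrite leNgt x0 in xN.
have Nx : (N%:R%:E < x%:E)%E.
  by rewrite lte_fin ltNge; apply/negP => /Nmin; rewrite ltnn.
move=> /(lt_le_trans Nx) /ereal_sup_gt[_ [g gw <-]].
by rewrite lte_fin ltr_nat => Ng; exists g => //; apply: le_trans xN _; rewrite ler_nat.
Qed.

Lemma max_height_leE n (x : R) :
  [set w | (max_height (env w) n <= x%:E)%E] =
  ~` [set w | exists2 g, x < (height g)%:R &
    geodesic (env w) (pt 0 0) (pt n%:Z 0) g].
Proof.
rewrite /max_height -pt0 pt_e1; apply/seteqP; split=> w /=.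
  move=> H [g xg gw]; have : ((height g)%:R%:E <= x%:E)%E.
    by apply: le_trans H; apply: ereal_sup_ubound; exists g.
  by rewrite lee_fin leNgt xg.
move=> H; apply: ge_ereal_sup => _ [g gw <-]; rewrite lee_fin leNgt.
by apply/negP => xg; apply: H; exists g.
Qed.

End Environment.

(** * Asymptotics of the height *)

Section Asymptotics.
Context {R : realType} {dm : measure_display} {Omega : measurableType dm}.
Context {P : probability Omega R}.
Variables (tau : Delta 1 -> {RV P >-> R}) (F : R -> R) (c beta : R).
Hypothesis tau_ge0 : forall D w, 0 <= tau D w.
Hypothesis tau_indep : mutually_independent tau.
Hypothesis tau_cdf : forall D t, cdf (tau D) t = (F t)%:E.
Hypothesis beta_ge1 : 1 <= beta.
Hypothesis c_gt0 : 0 < c.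
Hypothesis F_equiv : F t / (c * t `^ beta) @[t --> 0^'+] --> (1 : R).

Notation env w := (fun D => tau D w).
Let q := beta^-1.

Let beta_gt0 : 0 < beta. Proof. exact: lt_le_trans beta_ge1. Qed.
Let q_gt0 : 0 < q. Proof. by rewrite invr_gt0. Qed.
Let q_le1 : q <= 1. Proof. by rewrite invf_le1. Qed.

Let powRKq (x : R) : 0 <= x -> (x `^ q) `^ beta = x.
Proof. by move=> x0; rewrite -powRrM mulVf ?gt_eqF// powRr1. Qed.

Let powRKb (x : R) : 0 <= x -> (x `^ beta) `^ q = x.
Proof. by move=> x0; rewrite -powRrM mulfV ?gt_eqF// powRr1. Qed.

(** The substitution [t = x ^ q] makes the power law linear, [F (x ^ q) ~ c * x]; a ratio within 1/2
    of 1 gives both bounds. *)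
Lemma cdf_root_bounds : exists2 x0 : R, 0 < x0 &
  forall x, 0 < x -> x < x0 -> c / 2 * x <= F (x `^ q) <= 2 * c * x.
Proof.
have h : 0 < 2^-1 :> R by rewrite invr_gt0.
have [e /= e0 He] := (cvgrPdist_lt _ _).1 F_equiv _ h.
exists (e `^ beta) => [|x x0 xe]; first exact: powR_gt0.
have xq : 0 < x `^ q by exact: powR_gt0.
have : x `^ q < e.
  by rewrite -(powRKb (ltW e0)) gt0_ltr_powR// nnegrE ?powR_ge0// ltW.
move=> xqe; have := He (x `^ q); rewrite /ball/= sub0r normrN gtr0_norm//.
move=> /(_ xqe xq).
have cx : 0 < c * x by rewrite mulr_gt0.
rewrite powRKq ?(ltW x0)// ltr_norml.
rewrite -[F (x `^ q)](divfK (lt0r_neq0 cx)) mulfK ?gt_eqF//.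
set r := F _ / _ => /andP[r1 r2]; apply/andP; split.
  by rewrite mulrAC mulrC ler_wpM2r ?(ltW cx)//; lra.
by rewrite -[2 * c * x]mulrA ler_wpM2r ?(ltW cx)//; lra.
Qed.

Lemma natr_infty (r : R) : \forall n \near \oo, r < n%:R.
Proof.
exists (Num.truncn r).+1 => // n /= rn; apply: (lt_le_trans (truncnS_gt r)).
by rewrite ler_nat.
Qed.

Lemma div_infty (r e : R) : 0 < e -> \forall n \near \oo, r / n%:R < e.
Proof.
move=> e0; near=> n; have n0 : 0 < (n%:R : R) by near: n; exact: natr_infty.
rewrite ltr_pdivrMr// mulrC -ltr_pdivrMr//; near: n; exact: natr_infty.
Unshelve. all: by end_near.
Qed.

(** * Boxes without very fast lines, and existence of geodesics *)

Definition fast_box (z : R) (i : nat) : set Omega :=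
  some_fast tau (lines i) ((z / i%:R) `^ q).

Lemma fast_boxN z i w : (~` fast_box z i) w ->
  (z / i%:R) `^ q <= minline (env w) i.
Proof. by move=> H; apply/minlineP => D Di; apply/ltW/(some_fastN H). Qed.

(** A union bound: the box has [4 * i + 2 <= 6 * i] lines, each fast with probability at most
    [2 * c * (z / i)]. *)
Lemma rare_fast_box z : 0 < z ->
  \forall i \near \oo, rare (P := P) (fast_box z i) (12 * c * z).
Proof.
move=> z0; have [x0 x00 Fx] := cdf_root_bounds; near=> i.
have i0 : 0 < (i%:R : R) by near: i; exact: natr_infty.
have zi : z / i%:R < x0 by near: i; exact: div_infty.
apply: rare_le (rare_some_fast tau_cdf _ _); rewrite size_lines.
have /andP[_ /(ler_wpM2l (ler0n _ (6 * i)))] := Fx _ (divr_gt0 z0 i0) zi.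
have -> : (6 * i)%N%:R * (2 * c * (z / i%:R)) = 12 * c * z.
  by rewrite natrM; field; rewrite gt_eqF.
apply: le_trans; rewrite ler_wpM2r ?ler_nat//.
  by case/andP: (cdf_ge0_le1 tau_cdf ((z / i%:R) `^ q)).
by move: i0; rewrite ltr0n; clear; lia.
Unshelve. all: by end_near.
Qed.

Definition evtl_fast (z : R) : set Omega :=
  \bigcup_k \bigcap_(i in [set i | (k <= i)%N]) fast_box z i.

(** Each intersection lies in one [fast_box z i] with [i] large, and the union over [k] is
    increasing. *)
Lemma rare_evtl_fast z : 0 < z -> rare (P := P) (evtl_fast z) (12 * c * z).
Proof.
move=> z0; have mbox i : measurable (fast_box z i).
  by have [] := rare_some_fast tau_cdf (lines i) ((z / i%:R) `^ q).
have mcap k : measurable (\bigcap_(i in [set i | (k <= i)%N]) fast_box z i).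
  by apply: bigcap_measurableType => i _; exact: mbox.
apply: rare_bigcup => [k|j k jk w H i /= ki]; last first.
  by apply: H; exact: leq_trans ki.
split=> //; have [N _ HN] := rare_fast_box z0.
have [_] := HN (maxn k N) (leq_maxr _ _); apply: le_trans.
by apply: le_measure; rewrite ?inE//; apply: bigcap_inf; exact: leq_maxl.
Qed.

(** For infinitely many [i], [minline i] is at least [(z / i) ^ q]. This makes every minimum
    positive and, as [q <= 1], bounds [i * minline i] below. *)
Lemma evtl_fastN_geodesic z w : 0 < z -> (~` evtl_fast z) w ->
  forall x y, exists g, geodesic (env w) x y g.
Proof.
move=> z0 H x y.
have io k : exists2 i, (k <= i)%N & (z / i%:R) `^ q <= minline (env w) i.
  apply: contrapT => /forall2NP H'; apply: H; exists k => // i /= ki.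
  by apply: contrapT => /fast_boxN; have [|] := H' i.
(* Capping [z] at 1 keeps the base at most 1, where raising to the power [q] can only increase
   it. *)
have z1 : 0 < Num.min z 1 by rewrite lt_min z0 ltr01.
apply: exists_geodesic => [D|r|]; first exact: tau_ge0.
  have [i ri zi] := io r.+1; apply: lt_le_trans (minline_nincr _ (ltnW ri)).
  apply: lt_le_trans zi; apply: powR_gt0; rewrite divr_gt0// ltr0n.
  exact: leq_trans ri.
apply: (summin_unbounded _ z1) => [D|k]; first exact: tau_ge0.
have [i ki zi] := io k.+1; exists i; first exact: ltnW.
have i0 : 0 < (i%:R : R) by rewrite ltr0n; exact: leq_trans ki.
rewrite mulrC -ler_pdivrMr//; apply: le_trans zi.
have zi0 : 0 < Num.min z 1 / i%:R by rewrite divr_gt0.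
apply: (@le_trans _ _ ((Num.min z 1 / i%:R) `^ q)).
  rewrite ger1_powR// zi0 ler_pdivrMr// mul1r ge_min ler1n.
  by rewrite (leq_trans _ ki) ?orbT.
rewrite ge0_ler_powR ?(ltW q_gt0)// ?nnegrE ?(ltW zi0)//.
  by rewrite divr_ge0 ?(ltW z0) ?(ltW i0).
by rewrite ler_pM2r ?invr_gt0// ge_min lexx.
Qed.

(** * Linear lower bound on the height *)

Lemma height_linear_lower (eta : R) : 0 < eta ->
  exists2 eps : R, 0 < eps & ((1 - eta)%:E <= limn_einf (fun n : nat =>
    P [set w | (eps * n%:R)%:E <= max_height (env w) n]))%E.
Proof.
(* One fifth of the error for each of the five events united in [B]; [z] is tuned to
   [12 * c * z = e]. *)
move=> eta0; pose e := eta / 5; have e0 : 0 < e by rewrite divr_gt0.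
pose z := e / (12 * c); have z0 : 0 < z by rewrite divr_gt0// mulr_gt0.
(* Among at least [n / 8] lines, each below [u] with probability at least [c / 2 * (X / n)], the
   expected number of fast ones is at least [c * X / 16 = 1 / e]. *)
pose X := 16 / (c * e); have X0 : 0 < X by rewrite divr_gt0// mulr_gt0.
(* The factor gives [s = 12 * u], so [n / 2] steps at price [s] cost [6 * n * u], more than the
   [5 * n * u] of the detour. *)
pose Y := 12 `^ beta * X; have Y0 : 0 < Y by rewrite mulr_gt0// powR_gt0.
(* The cap 1 ensures [m <= n]. The other value bounds the main part of the expected number of low
   rows below [s] by [e / 2]; the rest, [2 * c * Y / n], is small for large [n]. *)
pose eps := Num.min 1 (e / (8 * c * Y)).
have eps0 : 0 < eps by rewrite /eps lt_min ltr01 divr_gt0// mulr_gt0// mulr_gt0.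
exists eps => //; apply: limn_einf_ge.
have [x0 x00 Fx] := cdf_root_bounds.
near=> n.
have n4 : (4 <= n)%N by near: n; exists 4%N.
have n0 : 0 < (n%:R : R) by rewrite ltr0n; exact: leq_trans n4.
have Xn : X / n%:R < x0 by near: n; exact: div_infty.
have Yn : Y / n%:R < x0 by near: n; exact: div_infty.
have Yn' : 4 * c * Y / e < n%:R by near: n; exact: natr_infty.
set u := (X / n%:R) `^ q; set s := (Y / n%:R) `^ q.
have u0 : 0 < u by rewrite powR_gt0// divr_gt0.
have su : s = 12 * u.
  by rewrite /s /Y -mulrA powRM ?powR_ge0 ?(ltW (divr_gt0 X0 n0))// powRKb.
(* The two columns are sought in the first and last quarters of the segment, hence at least [n / 2]
   apart; [4 <= n] keeps the rounded quarter above [n / 8]. *)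
pose M := (n %/ 4)%N.
have M8 : (n <= M * 8)%N by rewrite /M; clear -n4; lia.
have M2 : (M + M + M + M <= n)%N by rewrite /M; clear; lia.
pose m := Num.truncn (eps * n%:R).
have en0 : 0 < eps * n%:R by rewrite mulr_gt0.
have mE : m%:R <= eps * n%:R by rewrite truncn_le ltW.
have mn : (m <= n)%N.
  by rewrite -(ler_nat R) (le_trans mE)// ler_piMl ?(ltW n0)// ge_min lexx.
pose l1 := [seq vline k%:Z | k <- iota 0 M].
pose l2 := [seq vline (n%:Z - k%:Z) | k <- iota 0 M].
pose l3 := [seq hline k%:Z | k <- iota 0 M].
have slow l : uniq l -> size l = M -> rare (P := P) (all_slow tau l u) e.
  move=> ul lM; rewrite -[e]invrK; apply: rare_all_slow => //.
    by rewrite invr_gt0.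
  left; rewrite lM; have /andP[Fu _] := Fx _ (divr_gt0 X0 n0) Xn.
  apply: (@le_trans _ _ (n%:R / 8 * (c / 2 * (X / n%:R)))).
    rewrite le_eqVlt; apply/orP; left; apply/eqP; rewrite /X; field.
    by rewrite !gt_eqF.
  apply: ler_pM => //; last first.
    by rewrite ler_pdivrMr// -natrM ler_nat.
  by apply/ltW/(mulr_gt0 _ (divr_gt0 X0 n0)); rewrite divr_gt0.
pose B := evtl_fast z `|` all_slow tau l1 u `|` all_slow tau l2 u
  `|` all_slow tau l3 u `|` some_fast tau [seq hline k | k <- ints m] s.
have rB : rare (P := P) B eta.
  have -> : eta = e + e + e + e + e by rewrite /e; lra.
  repeat apply: rare_setU.
  - rewrite (_ : e = 12 * c * z); first exact: rare_evtl_fast.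
    by rewrite /z; field; rewrite gt_eqF.
  - apply: slow; last by rewrite size_map size_iota.
    by rewrite map_inj_uniq ?iota_uniq// => i j /vline_inj; clear; lia.
  - apply: slow; last by rewrite size_map size_iota.
    by rewrite map_inj_uniq ?iota_uniq// => i j /vline_inj; clear; lia.
  - apply: slow; last by rewrite size_map size_iota.
    by rewrite map_inj_uniq ?iota_uniq// => i j /hline_inj; clear; lia.
  - apply: rare_le (rare_some_fast tau_cdf _ _); rewrite size_map size_ints.
    have /andP[_ Fs] := Fx _ (divr_gt0 Y0 n0) Yn.
    apply: le_trans (_ : (2 * (eps * n%:R) + 1) * (2 * c * (Y / n%:R)) <= _).
      apply: ler_pM => //; first by case/andP: (cdf_ge0_le1 tau_cdf s).
      by rewrite -addn1 natrD lerD2r -muln2 natrM mulrC ler_pM2l.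
    have -> : (2 * (eps * n%:R) + 1) * (2 * c * (Y / n%:R)) =
        4 * c * Y * eps + 2 * c * Y / n%:R by field; rewrite gt_eqF.
    have H1 : 4 * c * Y * eps <= e / 2.
      have -> : e / 2 = 4 * c * Y * (e / (8 * c * Y)) by field; rewrite !gt_eqF.
      by rewrite ler_pM2l ?ge_min ?lexx ?orbT// mulr_gt0// mulr_gt0.
    have H2 : 2 * c * Y / n%:R <= e / 2.
      rewrite ler_pdivrMr//; move: Yn'; rewrite ltr_pdivrMr//; lra.
    by lra.
apply: (prob_ge _ rB).
  rewrite max_height_geE//; exact: measurable_geodesics.
move=> w; rewrite max_height_geE// /B !setCU => -[[[[w1 w2] w3] w4] w5].
have [g gw] := evtl_fastN_geodesic z0 w1 (pt 0 0) (pt n%:Z 0).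
have [_ /mapP[j + ->] tj] := all_slowN w2.
have [_ /mapP[j' + ->] tj'] := all_slowN w3.
have [_ /mapP[k + ->] tk] := all_slowN w4.
rewrite !mem_iota add0n !leq0n /= => kM jM' jM.
have kn : (k <= n)%N by clear -kM M2; lia.
have jj : (j + j + j' + j' <= n)%N by clear -jM jM' M2; lia.
have sm (i : int) : (`|i| <= m)%N -> s <= tau (hline i) w.
  by rewrite -mem_ints => im; apply/ltW/(some_fastN w5)/map_f.
have mg : (m < height g)%N.
  apply: (low_not_geodesic _ _ _ _ _ _ _ tj tj' tk sm _ _ gw) => //;
    try by clear -jj kn; lia.
  - by rewrite su mulr_ge0// ltW.
  - have : n%:R / 2 <= (absz (n%:Z - j'%:Z - j%:Z)%R)%:R :> R.
      by rewrite ler_pdivrMr// -natrM ler_nat; clear -jj; lia.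
    move=> /(ler_wpM2r (ltW u0)) H; have := mulr_gt0 n0 u0; rewrite su; lra.
exists g => //; apply: (le_trans (ltW (truncnS_gt _))).
by rewrite ler_nat.
Unshelve. all: by end_near.
Qed.

(** * Linear upper bound on the height *)

(** At small scales of the zigzag the argument need not be small, so the linear bound is extended:
    by monotonicity up to [b ^ beta], with a smaller slope, and beyond it [F] is 1. *)
Lemma cdf_root_lower b : 0 < b -> F b = 1 -> exists2 c', 0 < c' &
  forall x, 0 < x -> c' * x <= F (x `^ q) \/ F (x `^ q) = 1.
Proof.
move=> b0 Fb; have [x0 x00 Fx] := cdf_root_bounds.
have bb0 : 0 < b `^ beta by exact: powR_gt0.
have c20 : 0 < c / 2 by rewrite divr_gt0.
pose y := x0 / 2; have y0 : 0 < y by rewrite divr_gt0.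
have yx0 : y < x0 by rewrite /y; lra.
have r0 : 0 < y / b `^ beta by rewrite divr_gt0.
exists (c / 2 * Num.min 1 (y / b `^ beta)) => [|x x_gt0].
  by rewrite mulr_gt0// lt_min ltr01.
have ndF := cdf_homo tau_cdf.
have [xx0|x0x] := ltP x x0.
  left; have /andP[+ _] := Fx _ x_gt0 xx0; apply: le_trans.
  by rewrite ler_pM2r// ger_pMr// ge_min lexx.
have [xb|bx] := leP x (b `^ beta).
  left; apply: (@le_trans _ _ (c / 2 * y)).
    rewrite -[c / 2 * _ * x]mulrA ler_pM2l// -[leRHS](@divfK _ (b `^ beta)) ?gt_eqF//.
    by rewrite ler_pM// ?(ltW x_gt0)// ?ge_min ?lexx ?orbT// le_min ler01 ltW.
  have /andP[+ _] := Fx _ y0 yx0; move/le_trans; apply; apply: ndF.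
  rewrite ge0_ler_powR ?(ltW q_gt0)// ?nnegrE ?ltW//.
  exact: lt_le_trans yx0 x0x.
right; apply/eqP; rewrite eq_le; case/andP: (cdf_ge0_le1 tau_cdf (x `^ q)) => _ ->/=.
rewrite -Fb; apply: ndF; rewrite -(powRKb (ltW b0)).
by rewrite ge0_ler_powR ?(ltW q_gt0)// ?nnegrE ltW.
Qed.

Lemma height_linear_upper (b : R) : 1 < beta -> 0 < b -> F b = 1 ->
  forall eta : R, 0 < eta ->
  exists2 K : R, 0 < K & ((1 - eta)%:E <= limn_einf (fun n : nat =>
    P [set w | max_height (env w) n <= (K * n%:R)%:E]))%E.
Proof.
move=> beta_gt1 b0 Fb eta eta0.
have [c' c'0 Fc'] := cdf_root_lower b0 Fb.
have q_lt1 : q < 1 by rewrite invf_lt1.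
pose alpha := 1 - q; have alpha0 : 0 < alpha by rewrite subr_gt0.
pose e := eta / 2; have e0 : 0 < e by rewrite divr_gt0.
pose z := e / (12 * c); have z0 : 0 < z by rewrite divr_gt0// mulr_gt0.
(* The ratio [rho] balances the two geometric series which bound the
   probability that some scale is bad and the cost of the zigzag. *)
have [rho [rho1 th1]] : exists rho : R, 1 < rho /\ rho `^ q < 2 `^ alpha.
  have h : 0 < alpha / 2 by rewrite divr_gt0.
  have p1 (a : R) : 0 < a -> (1 : R) < 2 `^ a.
    move=> a0; rewrite [ltLHS](_ : _ = 1 `^ a); last by rewrite powR1.
    by rewrite gt0_ltr_powR// ?nnegrE// ltr1n.
  (* With this choice [rho ^ q = 2 ^ (alpha / 2)], strictly between 1 and [2 ^ alpha]. *)
  exists ((2 `^ (alpha / 2)) `^ beta); split.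
    by rewrite -powRrM p1// mulr_gt0.
  have -> : 2 `^ alpha = 2 `^ (alpha / 2) * 2 `^ (alpha / 2) :> R.
    by rewrite -powRD -?splitr ?pnatr_eq0 ?implybT.
  by rewrite powRKb ?powR_ge0// ltr_pMr ?powR_gt0// p1.
have rho0 : 0 < rho by exact: lt_trans rho1.
pose th := rho `^ q / 2 `^ alpha.
have th0 : 0 < th by rewrite divr_gt0 ?powR_gt0.
have {}th1 : th < 1 by rewrite ltr_pdivrMr ?powR_gt0// mul1r.
have rV0 : 0 < rho^-1 by rewrite invr_gt0.
have rV1 : rho^-1 < 1 by rewrite invf_lt1.
(* The failure bounds [3 / (c' * X * rho ^+ (m - i))] then sum over [i] to at most [e]. *)
pose X := 3 / (c' * e * (1 - rho^-1)).
have X0 : 0 < X by rewrite divr_gt0// mulr_gt0 ?subr_gt0// mulr_gt0.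
(* The zigzag will cost at most [C * n ^ alpha]; the factor [2 ^ alpha] comes from
   [2 ^ m <= 2 * n]. *)
pose C := 2 * b + 16 * (X `^ q * 2 `^ alpha / (1 - th)).
have [K K0 CK] : exists2 K : nat, (0 < K)%N & C < z `^ q * K%:R `^ alpha.
  have C0 : 0 < C.
    have A0 : 0 < X `^ q * 2 `^ alpha / (1 - th).
      by rewrite divr_gt0 ?subr_gt0// mulr_gt0 ?powR_gt0.
    by rewrite addr_gt0// mulr_gt0.
  exists (Num.truncn ((C / z `^ q) `^ alpha^-1)).+1 => //.
  rewrite mulrC -ltr_pdivrMr ?powR_gt0//.
  have {1}-> : C / z `^ q = ((C / z `^ q) `^ alpha^-1) `^ alpha.
    by rewrite -powRrM mulVf ?gt_eqF// powRr1// divr_ge0 ?powR_ge0 ?(ltW C0).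
  by rewrite gt0_ltr_powR ?nnegrE ?powR_ge0// truncnS_gt.
exists K%:R; first by rewrite ltr0n.
apply: limn_einf_ge; near=> n.
have n0 : (0 < n)%N by near: n; exists 1%N.
have Kbox : rare (P := P) (fast_box z (K * n)) (12 * c * z).
  near: n; have [N _ HN] := rare_fast_box z0; exists N => // n /= Nn.
  by apply: HN => /=; apply: leq_trans Nn _; rewrite leq_pmull.
pose m := up_log 2 n.
have nm : (n <= 2 ^ m)%N by apply: up_logP.
have mn : (2 ^ m <= 2 * n)%N.
  have [n1|n1] := leqP n 1.
    by rewrite /m (_ : n = 1%N) ?up_log1//; apply/eqP; rewrite eqn_leq n1.
  have /andP[mn _] := up_log_bounds (isT : (1 < 2)%N) n1.
  have m0 : (0 < m)%N by rewrite up_log_gt0.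
  by rewrite -(prednK m0) expnS leq_mul2l (ltnW mn).
(* Up to [c'], a lower bound on the expected number of lines below [u i] among [2 ^ i] candidates,
   unless all are. It grows as [i] decreases, so the failures sum uniformly in [m]. *)
pose y i := X * rho ^+ (m - i).
have y0 i : 0 < y i by rewrite mulr_gt0// exprn_gt0.
pose u i := (y i / 2 ^+ i) `^ q.
have pow0 i : 0 < (2 ^+ i : R) by rewrite exprn_gt0.
pose slow i := all_slow tau [seq vline k%:Z | k <- iota (2 ^ i) (2 ^ i)] (u i) `|`
  all_slow tau [seq vline (n%:Z - k%:Z) | k <- iota (2 ^ i) (2 ^ i)] (u i) `|`
  all_slow tau [seq hline k%:Z | k <- iota (2 ^ i) (2 ^ i)] (u i).
have slow1 i l : uniq l -> size l = (2 ^ i)%N ->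
    rare (P := P) (all_slow tau l (u i)) (c' * y i)^-1.
  move=> ul li; apply: rare_all_slow => //; first by rewrite mulr_gt0.
  rewrite li natrX; have [Fu|Fu] := Fc' _ (divr_gt0 (y0 i) (pow0 i)).
    left; apply: le_trans (ler_wpM2l (ltW (pow0 i)) Fu).
    rewrite le_eqVlt; apply/orP; left; apply/eqP; field; by rewrite gt_eqF.
  by right; rewrite expn_gt0.
have rslow i : rare (P := P) (slow i) (3 * (c' * y i)^-1).
  have -> : 3 * (c' * y i)^-1 = (c' * y i)^-1 + (c' * y i)^-1 + (c' * y i)^-1.
    by lra.
  repeat apply: rare_setU; apply: slow1; rewrite ?size_map ?size_iota//;
    rewrite map_inj_uniq ?iota_uniq// => j k.
  - by move=> /vline_inj; clear; lia.
  - by move=> /vline_inj; clear; lia.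
  - by move=> /hline_inj; clear; lia.
pose B := \big[setU/set0]_(i < m.+1) slow i `|` fast_box z (K * n) `|`
  all_slow tau [:: hline 0] b.
have rB : rare (P := P) B eta.
  have -> : eta = e + 12 * c * z + 0 by rewrite /z /e; field; rewrite gt_eqF.
  apply: rare_setU; last first.
    split; first exact: measurable_all_slow.
    by rewrite (prob_all_slow tau_indep tau_cdf)// Fb subrr.
  apply: rare_setU => //.
  apply: rare_le (rare_bigsetU _ (fun i : 'I_m.+1 => rslow i)).
  rewrite (eq_bigr (fun i : 'I_m.+1 => 3 / (c' * X) * rho^-1 ^+ (m - i))); last first.
    by move=> i _; rewrite /y mulrA invfM exprVn mulrA.
  rewrite -mulr_sumr; have := sum_geometric_le m (ltW rV0) rV1.
  have d0 : 0 < 3 / (c' * X) by rewrite divr_gt0// mulr_gt0.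
  move=> /(ler_wpM2l (ltW d0)) /le_trans; apply.
  rewrite le_eqVlt; apply/orP; left; apply/eqP; rewrite /X; field.
  by rewrite !gt_eqF ?subr_gt0.
apply: (prob_ge _ rB).
  rewrite max_height_leE; apply: measurableC; exact: measurable_geodesics.
move=> w; rewrite max_height_leE /B !setCU => -[[w1 w2] w3] [g Kg gw].
have tau_w D : 0 <= tau D w := tau_ge0 D w.
have Kg' : (K * n < height g)%N by rewrite -(ltr_nat R) natrM.
have lower := tall_passage_time tau_w gw Kg'.
have h0 : tau (hline 0) w <= b.
  by have [D] := all_slowN w3; rewrite inE => /eqP ->.
have fast i : (i <= m)%N -> (~` slow i) w.
  move=> im si; apply: w1; rewrite -bigcup_mkord; exists i => //=.
have pick (l : int -> Delta 1) : (forall i, (i <= m)%N -> exists2 D,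
    D \in [seq l k%:Z | k <- iota (2 ^ i) (2 ^ i)] & tau D w <= u i) ->
  exists xs : nat -> int, forall i, (2 ^ i)%N%:Z <= xs i < (2 ^ i.+1)%N%:Z /\
    ((i <= m)%N -> tau (l (xs i)) w <= u i).
  move=> H; suff /choice[xs xsP] : forall i, exists x : int,
      (2 ^ i)%N%:Z <= x < (2 ^ i.+1)%N%:Z /\ ((i <= m)%N -> tau (l x) w <= u i).
    by exists xs.
  move=> i.
  have e2 : (2 ^ i.+1 = 2 * 2 ^ i)%N by rewrite expnS.
  have i20 : (0 < 2 ^ i)%N by rewrite expn_gt0.
  have [im|im] := leqP i m; last first.
    (* Scales above [m] get an arbitrary point of their dyadic interval, so that the sequence is
       total. *)
    by exists (2 ^ i)%N%:Z; split=> //; clear -e2 i20; lia.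
  have [_ /mapP[k + ->] tk] := H _ im; rewrite mem_iota => ki.
  by exists k%:Z; split=> //; clear -e2 ki; lia.
have [xs xsP] : exists xs : nat -> int, forall i,
    (2 ^ i)%N%:Z <= xs i < (2 ^ i.+1)%N%:Z /\
    ((i <= m)%N -> tau (vline (xs i)) w <= u i).
  by apply: pick => i /fast; rewrite !setCU => -[[/all_slowN]].
have [xs' xsP'] : exists xs : nat -> int, forall i,
    (2 ^ i)%N%:Z <= xs i < (2 ^ i.+1)%N%:Z /\
    ((i <= m)%N -> tau (vline (n%:Z - xs i)) w <= u i).
  apply: (pick (fun k => vline (n%:Z - k))) => i /fast.
  by rewrite !setCU => -[[_ /all_slowN]].
have [ys ysP] : exists xs : nat -> int, forall i,
    (2 ^ i)%N%:Z <= xs i < (2 ^ i.+1)%N%:Z /\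
    ((i <= m)%N -> tau (hline (xs i)) w <= u i).
  by apply: pick => i /fast; rewrite !setCU => -[_ /all_slowN].
have := dyadic_upper_bound tau_w nm (fun i => (xsP i).1) (fun i => (xsP' i).1)
  (fun i => (ysP i).1)
  (fun i im => And3 ((xsP i).2 im) ((xsP' i).2 im) ((ysP i).2 im)) gw.
apply/negP; rewrite -ltNge; apply: lt_le_trans lower.
have nR0 : 0 < (n%:R : R) by rewrite ltr0n.
have Kn0 : 0 < ((K * n)%N%:R : R) by rewrite ltr0n muln_gt0 K0.
apply: (@lt_le_trans _ _ ((K * n)%N%:R * (z / (K * n)%N%:R) `^ q)); last first.
  by rewrite ler_pM2l//; exact: fast_boxN.
rewrite mulr_div_powR ?(ltW z0)// -/alpha natrM powRM// mulrA.
have na1 : 1 <= (n%:R : R) `^ alpha.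
  rewrite [leLHS](_ : _ = 1 `^ alpha); last by rewrite powR1.
  by rewrite ge0_ler_powR ?(ltW alpha0)// ?nnegrE// ler1n.
apply: (@le_lt_trans _ _ (C * n%:R `^ alpha)); last first.
  by rewrite ltr_pM2r// powR_gt0.
rewrite /C [leRHS]mulrDl lerD//.
  by rewrite -mulrA ler_pM2l// (le_trans h0)// ler_peMr// ltW.
rewrite -mulrA ler_pM2l//.
(* The cost at scale [i] is [y i ^ q * (2 ^+ i) ^ alpha]; writing [2 ^+ i] as
   [2 ^+ m / 2 ^+ (m - i)] shows a geometric sequence of ratio [th < 1]. *)
have term (i : 'I_m.+1) : true ->
    2 ^+ i * u i = X `^ q * (2 ^+ m) `^ alpha * th ^+ (m - i).
  move=> _; have im : (i <= m)%N by rewrite -ltnS.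
  rewrite /u mulr_div_powR ?(ltW (y0 i))// -/alpha /y.
  rewrite powRM ?exprn_ge0 ?(ltW X0) ?(ltW rho0)//.
  have -> : 2 ^+ m = 2 ^+ (m - i) * 2 ^+ i :> R by rewrite -exprD subnK.
  rewrite powRM ?exprn_ge0// !powR_exprn ?(ltW rho0)//.
  rewrite /th expr_div_n; field.
  by rewrite expf_neq0// gt_eqF// powR_gt0.
rewrite (eq_bigr _ term) -mulr_sumr.
have := sum_geometric_le m (ltW th0) th1.
have d0 : 0 < X `^ q * (2 ^+ m) `^ alpha by rewrite mulr_gt0 ?powR_gt0.
move=> /(ler_wpM2l (ltW d0)) /le_trans; apply.
rewrite [leRHS]mulrAC ler_pM2r ?invr_gt0 ?subr_gt0// -mulrA ler_pM2l ?powR_gt0//.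
rewrite -powRM// ge0_ler_powR ?(ltW alpha0)// ?nnegrE ?mulr_ge0// ?exprn_ge0//.
by rewrite -natrX -natrM ler_nat.
Unshelve. all: by end_near.
Qed.

End Asymptotics.

(* [Delta 1] is the set of integer lines of Z^2. *)
Theorem theorem2p3 (R : realType) (dm : measure_display)
  (Omega : measurableType dm) (P : probability Omega R)
  (tau : Delta 1 -> {RV P >-> R}) (F : R -> R) (c beta : R)
  (tau_ge0 : forall D w, 0 <= tau D w)
  (tau_indep : mutually_independent tau)
  (tau_cdf : forall D t, cdf (tau D) t = (F t)%:E)
  (a0 : inf (support_cdf F) = 0)
  (beta_ge1 : 1 <= beta) (c_gt0 : 0 < c)
  (F_equiv : F t / (c * t `^ beta) @[t --> 0^'+] --> (1 : R)) :
  (forall eta : R, 0 < eta ->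
     exists2 eps : R, 0 < eps &
       ((1 - eta)%:E <=
        limn_einf (fun n : nat =>
          P [set w | (eps * n%:R)%:E <= max_height (fun D => tau D w) n]))%E)
  /\
  (bounded_set (support_cdf F) -> 1 < beta ->
   forall eta : R, 0 < eta ->
     exists2 K : R, 0 < K &
       ((1 - eta)%:E <=
        limn_einf (fun n : nat =>
          P [set w | max_height (fun D => tau D w) n <= (K * n%:R)%:E]))%E).
Proof.
split=> [|bS beta_gt1].
  exact: (height_linear_lower tau_ge0 tau_indep tau_cdf beta_ge1 c_gt0 F_equiv).
have [b b_gt0 Fb] := cdf_one (cdf_homo tau_cdf) (cdf_cvg1 tau_cdf) bS.
exact: (height_linear_upper tau_ge0 tau_indep tau_cdf beta_ge1 c_gt0 F_equiv
  beta_gt1 b_gt0 Fb).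
Qed.
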